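(* Let $P$ be a convex polytope of dimension $d\ge 1$. There exists a pointed triangulation $\mathcal{C}_P$ of $P$, with apexes $\mathbf{v}_F$ ($F$ a nonempty face of $P$), such that the polytope number sequence $(P(n))_{n\ge 0}$ of $P$ defined from these apexes satisfies, for all $n\ge 1$, $$P(n)=\sum_{j=0}^{d-1} h_j\,\alpha^d(n-j),$$ where $(h_0,\dots,h_{d+1})$ is the $h$-vector of $\mathcal{C}_P$.
   Context: A polytope is the convex hull of a finite subset of some Euclidean space; its faces include $\emptyset$ and the polytope itself, and $\mathrm{Vert}(F)$ is the vertex set of $F$. A triangulation of $P$ is a finite collection $\mathcal{C}_P$ of simplices (containing the empty simplex), closed under taking faces, in which any two members meet in a common face, and with union $P$. For a face $F$ of $P$, $\mathcal{C}_F=\{\sigma\in\mathcal{C}_P:\sigma\subseteq F\}$ denotes the induced triangulation of $F$. Pointed triangulation: a triangulation $\mathcal{C}_P$ of $P$ together with a designated vertex $\mathbf{v}_F\in \mathrm{Vert}(F)$ (the apex of $F$) for each nonempty face $F$ of $P$ such that (1) for each $k$ and each $k$-face $F$ of $P$, every $k$-simplex of $\mathcal{C}_F$ contains $\mathbf{v}_F$; (2) for any two faces $F_1,F_2$, if $\{\mathbf{v}_{F_1},\mathbf{v}_{F_2}\}\subset F_1\cap F_2$ then $\mathbf{v}_{F_1}=\mathbf{v}_{F_2}$; (3) for each $F$ and each $\mathbf{w}\in\mathrm{Vert}(F)\setminus\{\mathbf{v}_F\}$, the segment joining $\mathbf{v}_F$ and $\mathbf{w}$ belongs to $\mathcal{C}_F$.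 $f$- and $h$-vectors: for a $d$-dimensional simplicial complex, $f_i$ is the number of $i$-dimensional simplices ($f_{-1}=1$), and for $0\le k\le d+1$, $h_k=\sum_{i=0}^{k}(-1)^{k-i}\binom{d+1-i}{d+1-k}f_{i-1}$. Polytope numbers: given apexes $\mathbf{v}_F$, the sequences $F(n)$ and $F(n)^\#$ (interior polytope numbers), $n\ge 0$, are defined for all nonempty faces $F$ of $P$ (including $P$) by induction on dimension and $n$. If $\dim F=0$: $F(0)=F(0)^\#=0$ and $F(n)=F(n)^\#=1$ for $n\ge1$. If $\dim F>0$: $F(0)=F(0)^\#=0$, $F(1)=1$, $F(1)^\#=0$, and for $n\ge2$, $$F(n)=F(n-1)+\sum_{G:\ \mathbf{v}_F\notin G}G(n)^\#,\qquad F(n)^\#=F(n)-\sum_{G\ne F}G(n)^\#,$$ where $G$ ranges over nonempty faces of $F$ satisfying the indicated condition. Simplex numbers: $\alpha^d(m)=\binom{m+d-1}{d}$ for $m\ge1$ and $\alpha^d(m)=0$ for $m\le 0$. *)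

(* Defs.v *)
From mathcomp Require Import all_boot all_order all_algebra.
From mathcomp Require Import finmap.
From mathcomp Require Import boolp classical_sets cardinality fsbigop reals.
From mathcomp Require Import convex.

Set Implicit Arguments.
Unset Strict Implicit.
Unset Printing Implicit Defensive.

Import Order.TTheory GRing.Theory Num.Theory.
Local Open Scope classical_set_scope.
Local Open Scope ring_scope.

Section Polytopes.
Context (R : realType) (N : nat).
Local Notation E := ('rV[R]_N).

Definition conv_hull (A : set E) : set E := smallest (@convex_set R E) A.

Definition polytope (P : set E) : Prop :=
  exists2 X : set E, finite_set X & P = conv_hull X.

(* The zero functional, with b = 0 and with b = 1, yields the improper face P
   and the empty face. *)
Definition face (P F : set E) : Prop :=
  exists (c : E) (b : R),
    (forall x, P x -> \sum_i c 0 i * x 0 i <= b) /\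
    F = [set x | P x /\ \sum_i c 0 i * x 0 i = b].

Definition nonempty_face (P F : set E) : Prop := face P F /\ F !=set0.

Definition Vert (F : set E) : set E := [set x | face F [set x]].

Definition aff_indep (s : seq E) : bool :=
  if s is x :: t then free [seq y - x | y <- t] else true.

(* The dimension of the affine hull of A, as one less than the largest size of
   an affinely independent family in A. Such families have at most N + 1
   members, so the range of k is no restriction; affdim set0 = -1. *)
Definition affdim (A : set E) : int :=
  (\max_(k < N.+2 |
      `[< exists s : seq E,
            [/\ size s = k, aff_indep s & [set` s] `<=` A] >]) k)%:Z - 1.

Definition simplex (sigma : set E) : Prop :=
  exists2 s : seq E, aff_indep s & sigma = conv_hull [set` s].

Definition triangulation (P : set E) (C : set (set E)) : Prop :=
  [/\ finite_set C /\ C set0,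
      (forall sigma, C sigma -> simplex sigma),
      (forall sigma tau, C sigma -> face sigma tau -> C tau),
      (forall sigma tau, C sigma -> C tau ->
         face sigma (sigma `&` tau) /\ face tau (sigma `&` tau)) &
      \bigcup_(sigma in C) sigma = P].

Definition induced (C : set (set E)) (F : set E) : set (set E) :=
  [set sigma | C sigma /\ sigma `<=` F].

Definition pointed_triangulation
    (P : set E) (C : set (set E)) (v : set E -> E) : Prop :=
  [/\ triangulation P C,
      (forall F, nonempty_face P F -> Vert F (v F)),
      (forall (k : nat) F sigma, nonempty_face P F -> affdim F = k%:Z ->
         induced C F sigma -> affdim sigma = k%:Z -> sigma (v F)),
      (forall F1 F2, nonempty_face P F1 -> nonempty_face P F2 ->
         [set v F1; v F2] `<=` F1 `&` F2 -> v F1 = v F2) &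
      (forall F w, nonempty_face P F -> (Vert F `\ v F) w ->
         induced C F (conv_hull [set v F; w]))].

Definition fvec (C : set (set E)) (i : int) : nat :=
  #|` fset_set [set sigma | C sigma /\ affdim sigma = i]|.

(* The h-vector of a d-dimensional complex, for k <= d + 1. *)
Definition hvec (d : nat) (C : set (set E)) (k : nat) : int :=
  \sum_(0 <= i < k.+1)
    (-1) ^+ (k - i) * ('C(d.+1 - i, d.+1 - k))%:Z * (fvec C (i%:Z - 1))%:Z.

(* [num F n] is F(n) and [inum F n] is F(n)^#. The recursion determines both on
   all nonempty faces of P; values at other sets are irrelevant. *)
Definition polytope_numbers
    (P : set E) (v : set E -> E) (num inum : set E -> nat -> int) : Prop :=
  forall F, nonempty_face P F ->
    [/\ num F 0%N = 0 /\ inum F 0%N = 0,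
        (affdim F = 0 ->
           forall n, (1 <= n)%N -> num F n = 1 /\ inum F n = 1) &
        (0 < affdim F ->
           [/\ num F 1%N = 1, inum F 1%N = 0 &
             forall n, (2 <= n)%N ->
               num F n = num F n.-1 +
                 \sum_(G \in [set G | nonempty_face F G /\ ~ G (v F)])
                   inum G n /\
               inum F n = num F n -
                 \sum_(G \in [set G | nonempty_face F G /\ G <> F])
                   inum G n])].

End Polytopes.

Definition alpha (d : nat) (m : int) : int :=
  if 1 <= m then ('C(`|m|%N + d - 1, d))%:Z else 0.

(* Main.v *)
Require Import Defs.
From mathcomp Require Import all_boot all_order all_algebra finmap.
From mathcomp Require Import boolp reals.
From mathcomp Require Import zify ring lra.

(** Order the vertices of P and let the apex of every nonempty face be its
least vertex. The pulling triangulation of P for this order has as simplices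
the convex hulls of the vertex sets S such that, for every nonempty subset T
of S, the apex of the smallest face containing T belongs to T. It is a pointed
triangulation: a point of a face F other than its apex lies on a segment from
the apex to a point of a smaller face that avoids the apex ([exit_point], an
application of Farkas' lemma), which gives covering by induction
([pulling_cover]); uniqueness of the simplex whose relative interior contains
a given point is obtained by removing the common apex from two representations
([pulling_unique]).

Polytope numbers count the simplices of this triangulation. For n at least 2,
F(n) is the sum of 'C(n - 2, dim S) over the nonempty simplices S of F, and the
interior number restricts the sum to the simplices that lie in no proper face
of F. The decomposition of F(n) along faces is immediate, and the recursion on
n is Pascal's rule, because the simplices of F form a cone from the apex over
those that avoid it ([simplex_countS]).

The h-vector formula comes from a half-open decomposition. Fix a point q of P
outside the affine hull of every simplex of dimension less than d. Pushing the
barycentre of a simplex S slightly towards q (and the empty simplex onto q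
itself) puts it inside exactly one maximal simplex M; this means that S lies between N(M) and M, where N(M) is the set of vertices of
M with nonpositive barycentric coordinate at q ([half_open_cells]). Hence h_k
is the number of maximal simplices M with #|N(M)| = k, and by Vandermonde's
identity each M contributes the simplex number of n - #|N(M)| to P(n)
([h_number_formula]). The terms of index d and d + 1 vanish: M contains the
apex v of P and M minus v lies in a face avoiding v, so the coordinate of q at
v is positive, and if all the others were nonpositive then v would not be a
vertex of P.

All the geometry takes place in the cone over P: a point x is replaced by the
vector (1, x), convex hulls by cones, affine independence by linear
independence, and barycentric coordinates by coefficients. *)

Set Implicit Arguments.
Unset Strict Implicit.
Unset Printing Implicit Defensive.

Import Order.TTheory GRing.Theory Num.Theory.
Local Open Scope ring_scope.

(** * Farkas' lemma *)

Section Dot.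
Context (R : comNzRingType) (n : nat).
Implicit Types x y c : 'rV[R]_n.

(** The standard inner product; [c] is thought of as a functional. *)
Definition dot x c : R := \sum_i c 0 i * x 0 i.

Lemma dotC x c : dot x c = dot c x.
Proof. by apply: eq_bigr => i _; rewrite mulrC. Qed.

Lemma dotDl x y c : dot (x + y) c = dot x c + dot y c.
Proof. by rewrite -big_split; apply: eq_bigr => i _; rewrite mxE mulrDr. Qed.

Lemma dotZl a x c : dot (a *: x) c = a * dot x c.
Proof. by rewrite mulr_sumr; apply: eq_bigr => i _; rewrite mxE mulrCA. Qed.

Lemma dotDr x c d : dot x (c + d) = dot x c + dot x d.
Proof. by rewrite dotC dotDl !(dotC x). Qed.

Lemma dotZr a x c : dot x (a *: c) = a * dot x c.
Proof. by rewrite dotC dotZl (dotC x). Qed.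

Lemma dotNl x c : dot (- x) c = - dot x c.
Proof. by rewrite -scaleN1r dotZl mulN1r. Qed.

Lemma dotBl x y c : dot (x - y) c = dot x c - dot y c.
Proof. by rewrite dotDl dotNl. Qed.

Lemma dotNr x c : dot x (- c) = - dot x c.
Proof. by rewrite dotC dotNl dotC. Qed.

Lemma dot0l c : dot 0 c = 0.
Proof. by rewrite -(scale0r 0) dotZl mul0r. Qed.

Lemma dot0r x : dot x 0 = 0.
Proof. by rewrite dotC dot0l. Qed.

Lemma dot_suml (I : finType) (Q : pred I) (F : I -> 'rV[R]_n) c :
  dot (\sum_(i | Q i) F i) c = \sum_(i | Q i) dot (F i) c.
Proof.
by apply: (big_morph (dot^~ c)) => [x y|]; [exact: dotDl | exact: dot0l].
Qed.

End Dot.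

Lemma dotxx_le0 (R : realDomainType) n (x : 'rV[R]_n) : dot x x <= 0 -> x = 0.
Proof.
move=> h; apply/rowP => i; rewrite mxE.
have := h; rewrite /dot (bigD1 i) //=.
have : 0 <= \sum_(j < n | j != i) x 0 j * x 0 j.
  by apply: sumr_ge0 => j _; rewrite -expr2 sqr_ge0.
have : 0 <= x 0 i * x 0 i by rewrite -expr2 sqr_ge0.
move=> h1 h2 h3; have : x 0 i * x 0 i == 0 by rewrite eq_le h1 andbT; lra.
by rewrite mulf_eq0 orbb => /eqP.
Qed.

Section Farkas.
Context (R : realFieldType) (n : nat) (I : finType).
Implicit Types (u : I -> 'rV[R]_n) (b c : 'rV[R]_n).

(** Farkas' lemma, by induction on the generators: if some [c0] is
nonpositive on all generators but the first and positive at [b], then project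
everything along the first generator onto the hyperplane orthogonal to [c0]. *)
Lemma farkas (r : seq I) u b : uniq r ->
  (forall c, {in r, forall i, dot (u i) c <= 0} -> dot b c <= 0) ->
  exists2 l : I -> R, {in r, forall i, 0 <= l i} & b = \sum_(i <- r) l i *: u i.
Proof.
elim: r u b => [|a r IH] u b /=.
  by move=> _ /(_ b) h; exists (fun=> 0) => //; rewrite big_nil; apply/dotxx_le0/h.
case/andP => aNr ur h.
have [h1|] := pselect (forall c, {in r, forall i, dot (u i) c <= 0} ->
  dot b c <= 0).
  have [l l0 ->] := IH u b ur h1.
  exists (fun i => if i == a then 0 else l i).
    by move=> i; rewrite inE; case: eqP => //= _; exact: l0.
  rewrite big_cons eqxx scale0r add0r; apply: eq_big_seq => i ir.
  by case: eqP ir => // ->; rewrite (negbTE aNr).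
move=> /existsNP[c0 /not_implyP[hc0 /negP]]; rewrite -ltNge => b0.
have a0 : 0 < dot (u a) c0.
  rewrite ltNge; apply/negP => ha; move: b0; rewrite ltNge => /negP; apply.
  by apply: h => i; rewrite inE => /predU1P[->|/hc0].
pose k (x : 'rV[R]_n) := dot x c0 / dot (u a) c0.
(* the projection of all the data onto the hyperplane orthogonal to c0 *)
pose p x := x - k x *: u a.
have [c|l l0 e] := IH (p \o u) (p b) ur.
  move=> hc.
  pose c' := c - (dot (u a) c / dot (u a) c0) *: c0.
  have pc x : dot (p x) c = dot x c'.
    by rewrite /p /k /c' dotBl dotZl dotDr dotNr dotZr; field; rewrite gt_eqF.
  rewrite pc; apply: h => i; rewrite inE => /predU1P[->|ir]; last first.
    by rewrite -pc; exact: hc.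
  by rewrite -pc /p /k divff ?gt_eqF // scale1r subrr dot0l.
exists (fun i => if i == a then k b - \sum_(i <- r) l i * k (u i) else l i).
  move=> i; rewrite inE; case: eqP => //= _; last exact: l0.
  move=> _; rewrite subr_ge0; apply: (@le_trans _ _ 0); last by rewrite divr_ge0 // ltW.
  rewrite big_seq; apply: sumr_le0 => j jr; rewrite mulr_ge0_le0 ?l0 //.
  by rewrite /k pmulr_lle0 ?invr_gt0 // hc0.
rewrite big_cons eqxx.
have -> : \sum_(j <- r) (if j == a then k b - \sum_(i <- r) l i * k (u i)
     else l j) *: u j = \sum_(j <- r) l j *: u j.
  apply: eq_big_seq => i ir; case: eqP ir => // ->; by rewrite (negbTE aNr).
have eb : b = p b + k b *: u a by rewrite /p subrK.
rewrite [LHS]eb e.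
have -> : \sum_(i <- r) l i *: (p \o u) i =
    \sum_(i <- r) l i *: u i - (\sum_(i <- r) l i * k (u i)) *: u a.
  rewrite scaler_suml -sumrB; apply: eq_bigr => i _.
  by rewrite /p /= scalerBr scalerA.
by rewrite scalerBl [LHS]addrC addrCA addrC.
Qed.

End Farkas.

(** * The pulling complex of a closure system *)

Section Pulling.
Local Open Scope nat_scope.
Local Open Scope set_scope.
Context (m : nat).
Implicit Types (L : {set {set 'I_m.+1}}) (A B S T : {set 'I_m.+1}).

(** The closure of [T] in a closure system [L]: the smallest member of [L]
containing [T]. When [L] is the face lattice of a polytope, on vertex indices,
this is the smallest face containing [T]. *)
Definition closure_of L T := \bigcap_(A in L | T \subset A) A.

(** The least element of [A]; the value at the empty set is irrelevant. *)
Definition apex A : 'I_m.+1 := [arg min_(i < odflt ord0 [pick j in A] in A) i].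

Lemma apexP A : A != set0 -> apex A \in A /\ forall i, i \in A -> apex A <= i.
Proof.
move=> /set0Pn[x xA]; rewrite /apex.
have h : odflt ord0 [pick j in A] \in A.
  by case: pickP => [//|/(_ x)]; rewrite xA.
by case: arg_minnP => // i iA hi; split.
Qed.

Lemma apex_in A : A != set0 -> apex A \in A.
Proof. by case/apexP. Qed.

Lemma apex_le A i : i \in A -> apex A <= i.
Proof. by move=> iA; apply: (apexP _).2 => //; apply/set0Pn; exists i. Qed.

Lemma apex_eq A a : a \in A -> (forall i, i \in A -> a <= i) -> apex A = a.
Proof.
move=> aA h; apply/val_inj/eqP; rewrite eqn_leq apex_le //= h // apex_in //.
by apply/set0Pn; exists a.
Qed.

(** The pulling complex of [L]: the sets all of whose nonempty subsets [T]
contain the apex of their closure. *)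
Definition pulling_complex L : {set {set 'I_m.+1}} :=
  [set S : {set 'I_m.+1} | [forall T : {set 'I_m.+1},
     (T \subset S) && (T != set0) ==> (apex (closure_of L T) \in T)]].

Variable L : {set {set 'I_m.+1}}.
Hypothesis LT : setT \in L.
Hypothesis L0 : set0 \in L.
Hypothesis LI : forall A B, A \in L -> B \in L -> A :&: B \in L.
Local Notation cl := (closure_of L).
Local Notation K := (pulling_complex L).

Lemma sub_closure T : T \subset cl T.
Proof. by apply/subsetP => x xT; apply/bigcapP => A /andP[_ /subsetP]; exact. Qed.

Lemma closure_in T : cl T \in L.
Proof.
by apply: (big_ind (fun A => A \in L)) => // A /andP[].
Qed.

Lemma closure_sub A T : A \in L -> T \subset A -> cl T \subset A.
Proof. by move=> AL TA; apply: bigcap_inf; rewrite AL. Qed.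

Lemma closure_subE A T : A \in L -> (cl T \subset A) = (T \subset A).
Proof.
move=> AL; apply/idP/idP; last exact: closure_sub.
by apply: subset_trans; exact: sub_closure.
Qed.

Lemma closure_id A : A \in L -> cl A = A.
Proof. by move=> AL; apply/eqP; rewrite eqEsubset closure_sub ?sub_closure. Qed.

Lemma closure_eq0 T : (cl T == set0) = (T == set0).
Proof.
apply/eqP/eqP => [h|->]; last exact: closure_id.
by apply/eqP; rewrite -subset0 -h sub_closure.
Qed.

Lemma pullingP S : reflect
  (forall T, T \subset S -> T != set0 -> apex (cl T) \in T) (S \in K).
Proof.
rewrite inE; apply: (iffP forallP) => h T; last by apply/implyP => /andP[]; exact: h.
by move=> TS T0; have /implyP -> := h T; rewrite ?TS.
Qed.

Lemma pulling_sub S T : S \in K -> T \subset S -> T \in K.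
Proof.
move=> /pullingP SK TS; apply/pullingP => T' T'T; apply: SK.
exact: subset_trans TS.
Qed.

Lemma pulling0 : set0 \in K.
Proof. by apply/pullingP => T; rewrite subset0 => /eqP ->; rewrite eqxx. Qed.

(** The members of the complex inside a closed set [A] are a cone with
vertex the apex of [A]. *)
Lemma pulling_cone A S : A \in L -> A != set0 -> S \in K -> S \subset A ->
  apex A |: S \in K.
Proof.
move=> AL A0 /pullingP SK SA; apply/pullingP => T TS T0.
have [aT|aT] := boolP (apex A \in T).
  have TA : T \subset A.
    by apply: subset_trans TS _; rewrite subUset SA andbT sub1set apex_in.
  rewrite (@apex_eq _ (apex A)) //; first by apply: (subsetP (sub_closure T)).
  by move=> i /(subsetP (closure_sub AL TA)) /apex_le.
apply: SK => //; apply/subsetP => x xT.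
have := subsetP TS x xT; rewrite !inE => /orP[/eqP xa|//].
by rewrite -xa xT in aT.
Qed.

Lemma pulling_apex A S : A \in L -> S \in K -> S \subset A ->
  (apex A \in cl S) = (apex A \in S).
Proof.
move=> AL /pullingP SK SA; apply/idP/idP; last exact/subsetP/sub_closure.
move=> aS; have S0 : S != set0.
  by rewrite -closure_eq0; apply/set0Pn; exists (apex A).
rewrite -(@apex_eq (cl S) (apex A)) ?SK // => i iS; apply: apex_le.
exact: (subsetP (closure_sub AL SA)).
Qed.

Lemma pulling1 i : [set i] \in L -> [set i] \in K.
Proof.
move=> iL; have i0 : [set i] != set0 by apply/set0Pn; exists i; rewrite inE.
have := pulling_cone iL i0 pulling0 (sub0set _); rewrite setU0.
by have := apex_in i0; rewrite inE => /eqP ->.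
Qed.

(** The polytope number of [A] of index [n + 2], as a count of simplices
weighted by dimension: a simplex of dimension [k] has ['C(n, k)] interior
points when dilated by [n + 1]. *)
Definition simplex_count A n := \sum_(S in K | (S != set0) && (S \subset A))
  'C(n, #|S|.-1).
(** The interior polytope number of [A] of index [n + 2]: only the simplices
that lie in no smaller closed set are counted. *)
Definition interior_count A n := \sum_(S in K | (S != set0) && (cl S == A))
  'C(n, #|S|.-1).

Lemma interior_count_sum (Q : pred {set 'I_m.+1}) n :
  \sum_(S in K | (S != set0) && Q (cl S)) 'C(n, #|S|.-1) =
  \sum_(B in L | (B != set0) && Q B) interior_count B n.
Proof.
rewrite (partition_big cl [pred B | [&& B \in L, B != set0 & Q B]]) /=; last first.
  by move=> S /and3P[_ S0 QS]; rewrite closure_in closure_eq0 S0.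
apply: eq_bigr => B /and3P[BL B0 QB]; apply: eq_bigl => S.
by rewrite -!andbA; case: (cl S =P B) => [->|]; rewrite ?QB ?andbF ?andbT.
Qed.

Lemma simplex_count_faces A n : A \in L ->
  simplex_count A n = \sum_(B in L | (B != set0) && (B \subset A)) interior_count B n.
Proof.
move=> AL; rewrite -(@interior_count_sum (fun B => B \subset A)).
by apply: eq_bigl => S; rewrite closure_subE.
Qed.

Lemma avoiding_count_faces A n : A \in L ->
  \sum_(S in K | [&& S != set0, S \subset A & apex A \notin S]) 'C(n, #|S|.-1) =
  \sum_(B in L | [&& B != set0, B \subset A & apex A \notin B]) interior_count B n.
Proof.
move=> AL; rewrite -(@interior_count_sum (fun B => (B \subset A) && (apex A \notin B))).
apply: eq_bigl => S; rewrite closure_subE //.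
case SK: (S \in K) => //=; case: (_ != _) => //=.
by case SA: (S \subset A) => //=; rewrite pulling_apex.
Qed.

(** A sum over the simplices in [A] pairs each simplex avoiding the apex with
its cone. *)
Lemma cone_sum A (w : nat -> nat) : A \in L -> A != set0 ->
  \sum_(S in K | S \subset A) w #|S| =
  \sum_(S in K | (S \subset A) && (apex A \notin S)) (w #|S| + w #|S|.+1).
Proof.
move=> AL A0; rewrite big_split /= (bigID (fun S => apex A \in S)) /= addnC.
congr addn; first by apply: eq_bigl => S; rewrite andbA.
rewrite (reindex_onto (fun T => apex A |: T) (fun S => S :\ apex A)); last first.
  by move=> S /andP[_]; exact: setD1K.
apply: eq_big => [T|T /andP[_ /eqP h]]; last first.
  by rewrite cardsU1 -{1}h !inE eqxx add1n.
rewrite setU11 andbT.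
have -> : ((apex A |: T) :\ apex A == T) = (apex A \notin T).
  apply/eqP/idP => [<-|/setU1K //]; by rewrite !inE eqxx.
case aT: (apex A \notin T); rewrite ?andbF ?andbT //.
rewrite subUset sub1set apex_in //=; apply: andb_id2r => TA.
apply/idP/idP => [/pulling_sub|]; first by apply; exact: subsetUr.
by move=> TK; exact: pulling_cone.
Qed.

(** The recursion for polytope numbers from index [n + 2] to index [n + 3]. *)
Lemma simplex_countS A n : A \in L -> A != set0 ->
  simplex_count A n.+1 = simplex_count A n +
    \sum_(B in L | [&& B != set0, B \subset A & apex A \notin B])
      interior_count B n.+1.
Proof.
move=> AL A0; rewrite -avoiding_count_faces //.
have E k : simplex_count A k = \sum_(S in K | S \subset A)
    (if #|S| is i.+1 then 'C(k, i) else 0).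
  rewrite /simplex_count [RHS]big_mkcond [LHS]big_mkcond; apply: eq_bigr => S _.
  rewrite -card_gt0; case: #|S| => [|i]; rewrite ?andbF //=.
  by case: ifP.
have -> : \sum_(S in K | [&& S != set0, S \subset A & apex A \notin S])
      'C(n.+1, #|S|.-1) = \sum_(S in K | (S \subset A) && (apex A \notin S))
    (if #|S| is i.+1 then 'C(n.+1, i) else 0).
  rewrite [RHS]big_mkcond [LHS]big_mkcond; apply: eq_bigr => S _.
  rewrite -card_gt0; case: #|S| => [|i]; rewrite ?andbF //=.
  by case: ifP.
rewrite !E !(@cone_sum A (fun k => if k is i.+1 then 'C(_, i) else 0)) //.
rewrite -big_split; apply: eq_bigr => S _ /=.
by case: #|S| => [|i]; rewrite ?bin0 // binS; lia.
Qed.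

(** The recursion for polytope numbers from index 1, where the value is 1,
to index 2. *)
Lemma simplex_count0 A : A \in L -> A != set0 ->
  simplex_count A 0 = 1 +
    \sum_(B in L | [&& B != set0, B \subset A & apex A \notin B])
      interior_count B 0.
Proof.
move=> AL A0; rewrite -avoiding_count_faces //.
have -> : simplex_count A 0 = \sum_(S in K | S \subset A)
    (if #|S| is i.+1 then 'C(0, i) else 0).
  rewrite /simplex_count [RHS]big_mkcond [LHS]big_mkcond; apply: eq_bigr => S _.
  rewrite -card_gt0; case: #|S| => [|i]; rewrite ?andbF //=.
  by case: ifP.
rewrite (@cone_sum A (fun k => if k is i.+1 then 'C(0, i) else 0)) //.
rewrite (bigD1 set0) /=; last by rewrite pulling0 sub0set in_set0.
rewrite cards0 bin0; congr addn; rewrite big_mkcond [RHS]big_mkcond.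
apply: eq_bigr => S _; rewrite -cards_eq0.
by case: #|S| => [|i] /=; rewrite ?andbF ?andbT //= bin0n addn0.
Qed.

End Pulling.

(** * Half-open decompositions and h-vectors *)

Section Binomials.

Lemma bin_trinomial D e l : (l <= e)%N -> (e <= D)%N ->
  ('C(D, l) * 'C(D - l, D - e) = 'C(D, e) * 'C(e, l))%N.
Proof.
move=> le eD.
have h1 := bin_fact (leq_trans le eD); have h2 := bin_fact eD.
have h3 := bin_fact le; have h4 : (D - e <= D - l)%N by lia.
move/bin_fact: h4; have -> : (D - l - (D - e) = e - l)%N by lia.
move=> h4; have p1 := fact_gt0 l; have p2 := fact_gt0 (e - l).
have p3 := fact_gt0 (D - e).
apply/eqP; rewrite -(@eqn_pmul2r (l`! * ((D - e)`! * (e - l)`!))) ?muln_gt0 ?p1 ?p2 ?p3 //.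
apply/eqP; transitivity D`!; first by rewrite -h1 -h4; ring.
by rewrite -h2 -h3; ring.
Qed.

Lemma alternating_binomials e :
  \sum_(l < e.+1) (-1) ^+ (e - l) * ('C(e, l))%:Z = (e == 0%N)%:Z.
Proof.
have := exprDn (-1 : int) 1 e; rewrite addNr expr0n -natz => ->.
by apply: eq_bigr => l _; rewrite expr1n mulr1 -natz mulr_natr.
Qed.

(** The coefficient with which a simplex of cardinality [s] enters [h_k]. *)
Definition hweight d k s : int :=
  if (s <= k)%N then (-1) ^+ (k - s) * ('C(d.+1 - s, d.+1 - k))%:Z else 0.

(** A Boolean interval of sets of cardinality between [j] and [d + 1]
contributes 1 to [h_j] and 0 to the other entries of the h-vector. *)
Lemma hweight_interval d k j : (j <= d.+1)%N -> (k <= d.+1)%N ->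
  \sum_(l < (d.+1 - j).+1) hweight d k (j + l) *+ 'C(d.+1 - j, l) = (j == k)%:Z.
Proof.
move=> jd kd; have [kj|jk] := ltnP k j.
  by rewrite big1 => [|l _]; rewrite ?(gtn_eqF kj) // /hweight leqNgt ltn_addr ?mul0rn.
set D := (d.+1 - j)%N; pose e := (k - j)%N.
have -> : (j == k)%:Z = (e == 0%N)%:Z by congr (nat_of_bool _)%:Z; rewrite /e; lia.
transitivity (('C(D, e))%:Z * (e == 0%N)%:Z : int); last first.
  by case: e => [|e] /=; rewrite ?bin0 ?mulr0.
rewrite -alternating_binomials mulr_sumr.
rewrite (big_ord_widen D.+1 (fun l => ('C(D, e))%:Z * ((-1) ^+ (e - l) * ('C(e, l))%:Z))); last by rewrite /D /e; lia.
rewrite [RHS]big_mkcond; apply: eq_bigr => l _; rewrite /hweight.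
have -> : (j + l <= k)%N = (l < e.+1)%N by rewrite /e; lia.
case: ifP => le; last by rewrite mul0rn.
have -> : (k - (j + l) = e - l)%N by rewrite /e; lia.
have -> : (d.+1 - (j + l) = D - l)%N by rewrite /D; lia.
have -> : (d.+1 - k = D - e)%N by rewrite /D /e; lia.
have h := @bin_trinomial D e l le (leq_sub2r j kd).
have : ('C(D, l) * 'C(D - l, D - e))%N%:Z = ('C(D, e) * 'C(e, l))%N%:Z by rewrite h.
rewrite !PoszM => {}h; rewrite -mulr_natr natz.
by rewrite -mulrA [X in _ * X]mulrC h; ring.
Qed.

(** The contribution of a simplex of cardinality [s] to the polytope number
of index [n + 2]; the empty simplex contributes nothing. *)
Definition cell_weight n s : int := if s is i.+1 then ('C(n, i))%:Z else 0.

(** Vandermonde's identity: a Boolean interval of sets of cardinality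
between [j] and [d + 1] contributes a simplex number. *)
Lemma cell_weight_interval d n j : (j < d)%N ->
  \sum_(l < (d.+1 - j).+1) cell_weight n (j + l) *+ 'C(d.+1 - j, l) =
  alpha d (n.+2%:Z - j%:Z).
Proof.
move=> jd; set D := (d.+1 - j)%N.
have -> : alpha d (n.+2%:Z - j%:Z) = ('C(n + D, d))%:Z.
  rewrite /alpha; case: ifP => h; last by rewrite bin_small //; lia.
  have [i ei] : exists i : nat, n.+2%:Z - j%:Z = i by exists (n.+2 - j)%N; lia.
  rewrite ei /=; congr ('C(_, _))%:Z; lia.
rewrite -binomial.Vandermonde (big_morph Posz PoszD (erefl _)).
transitivity (\sum_(s < d.+2) (if (j <= s)%N then
    cell_weight n s *+ 'C(D, s - j) else 0)).
  pose F s := if (j <= s)%N then cell_weight n s *+ 'C(D, s - j) else 0.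
  rewrite -(big_mkord xpredT F) (@big_cat_nat _ _ _ j) //=; last by lia.
  have -> : \sum_(0 <= s < j) F s = 0.
    by rewrite big_nat big1 // => s /andP[_ sj]; rewrite /F leqNgt sj.
  rewrite add0r (_ : \sum_(j <= s < d.+2) F s = \sum_(0 + j <= s < d.+2) F s) //.
  rewrite big_addn big_mkord.
  have -> : (d.+2 - j = D.+1)%N by rewrite /D; lia.
  by apply: eq_bigr => l _; rewrite /F leq_addl addnK addnC.
rewrite big_ord_recl /= mul0rn if_same add0r; apply: eq_bigr => s _.
rewrite /bump leq0n add1n /=; case: ifP => js.
  rewrite -mulr_natr natz -PoszM; congr Posz; congr muln.
  have sd := ltn_ord s; rewrite -(@bin_sub D (d - s)); last by rewrite /D; lia.
  by congr 'C(_, _); rewrite /D; lia.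
have sd := ltn_ord s; by rewrite (@bin_small D) ?muln0 // /D; lia.
Qed.

End Binomials.

Section HalfOpen.
Local Open Scope set_scope.
Context (I : finType) (K : {set {set I}}) (d : nat) (N : {set I} -> {set I}).
Implicit Types S M : {set I}.
Hypothesis Ksub : forall S M, M \in K -> S \subset M -> S \in K.
Local Notation top := [set M in K | #|M| == d.+1].
Local Notation meets M S := ((N M \subset S) && (S \subset M)).
Hypothesis cell_ex : forall S, S \in K -> exists2 M, M \in top & meets M S.
Hypothesis cell_uniq : forall S M M', S \in K -> M \in top -> M' \in top ->
  meets M S -> meets M' S -> M = M'.
Hypothesis Nsub : forall M, M \in top -> N M \subset M.
Hypothesis Nsmall : forall M, M \in top -> (#|N M| < d)%N.

Lemma interval_sum (V : nmodType) (w : nat -> V) S M : S \subset M ->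
  \sum_(T : {set I} | (S \subset T) && (T \subset M)) w #|T| =
  \sum_(l < (#|M| - #|S|).+1) w (#|S| + l)%N *+ 'C(#|M| - #|S|, l).
Proof.
move=> SM.
rewrite (reindex_onto (fun T => S :|: T) (fun T => T :\: S)) /=; last first.
  move=> T /andP[/subsetP ST _]; apply/setP => x; rewrite !inE.
  by case: (boolP (x \in S)) => //= /ST ->.
rewrite (eq_bigl (fun T : {set I} => T \subset M :\: S)); last first.
  move=> T; rewrite subsetUl subUset SM /= subsetD.
  apply: andb_id2l => TM; rewrite setDUl setDv set0U.
  by apply/eqP/idP => /setDidPl.
have cMS : #|M :\: S| = (#|M| - #|S|)%N by rewrite cardsD (setIidPr SM).
rewrite -cMS.
rewrite (partition_big (fun T : {set I} => inord #|T| : 'I_#|M :\: S|.+1) xpredT) //=.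
apply: eq_bigr => l _; rewrite -cards_draws.
rewrite (eq_bigl (fun T : {set I} => T \in [set A : {set I} | A \subset M :\: S & #|A| == l])); last first.
  move=> T; rewrite inE; apply: andb_id2l => TMS; rewrite -val_eqE /= inordK //.
  by rewrite ltnS subset_leq_card.
rewrite (eq_bigr (fun _ => w (#|S| + l)%N)) ?sumr_const // => T.
rewrite inE => /andP[TMS /eqP <-]; congr w.
rewrite cardsU; have -> : S :&: T = set0; last by rewrite cards0 subn0.
by apply/eqP; rewrite setIC setI_eq0; move: TMS; rewrite subsetD => /andP[].
Qed.

(** A sum over the complex [K] splits along the half-open cells, which are
the Boolean intervals from [N M] to [M]. *)
Lemma half_open_sum (V : nmodType) (w : nat -> V) :
  \sum_(S in K) w #|S| =
  \sum_(M in top) \sum_(l < (d.+1 - #|N M|).+1) w (#|N M| + l)%N *+ 'C(d.+1 - #|N M|, l).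
Proof.
transitivity (\sum_(M in top) \sum_(S : {set I} | meets M S) w #|S|); last first.
  apply: eq_bigr => M Mt; rewrite interval_sum ?Nsub //.
  by move: Mt; rewrite inE => /andP[_ /eqP ->].
rewrite (exchange_big_dep (fun S => S \in K)) /=; last first.
  by move=> M S; rewrite inE => /andP[MK _] /andP[_]; exact: Ksub.
apply: eq_bigr => S SK; have [M0 M0t M0S] := cell_ex SK.
rewrite (big_pred1 M0) // => M /=; apply/andP/eqP => [[Mt MS]|-> //].
exact: cell_uniq SK _ _ _ _.
Qed.

(** The number of simplices with [i] vertices, that is, [f_(i - 1)]. *)
Definition face_number i := #|[set S in K | #|S| == i]|.

(** The h-vector of a complex of dimension [d], in terms of [face_number]. *)
Definition h_number k : int :=
  \sum_(0 <= i < k.+1)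
    (-1) ^+ (k - i) * ('C(d.+1 - i, d.+1 - k))%:Z * (face_number i)%:Z.

Lemma h_numberE k : (k <= d.+1)%N ->
  h_number k = \sum_(M in top) (#|N M| == k)%:Z.
Proof.
move=> kd; transitivity (\sum_(S in K) hweight d k #|S|).
  rewrite (bigID (fun S => (#|S| < k.+1)%N)) /= [X in _ + X]big1 ?addr0; last first.
    by move=> S /andP[_]; rewrite /hweight ltnS => /negbTE ->.
  rewrite (partition_big (fun S => inord #|S| : 'I_k.+1) xpredT) //=.
  rewrite /h_number big_mkord; apply: eq_bigr => i _.
  rewrite (eq_bigl (fun S => S \in [set S in K | #|S| == i])); last first.
    move=> S; rewrite inE -andbA; apply: andb_id2l => _.
    apply/andP/eqP => [[Sk /eqP <-]|Si]; first by rewrite inordK.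
    by rewrite Si ltn_ord inord_val eqxx.
  rewrite (eq_bigr (fun _ => hweight d k i)); last first.
    by move=> S; rewrite inE => /andP[_ /eqP ->].
  by rewrite sumr_const /hweight -ltnS ltn_ord -mulr_natr natz.
rewrite half_open_sum; apply: eq_bigr => M /[dup] Mt.
rewrite inE => /andP[_ /eqP Md]; apply: hweight_interval => //.
by rewrite -Md subset_leq_card ?Nsub.
Qed.

Lemma h_number_sum n : 
  \sum_(0 <= k < d) h_number k * alpha d (n%:Z - k%:Z) =
  \sum_(M in top) alpha d (n%:Z - #|N M|%:Z).
Proof.
rewrite big_mkord.
under eq_bigr => k _.
  rewrite (h_numberE (leqW (ltnW (ltn_ord k)))) mulr_suml; over.
rewrite exchange_big; apply: eq_bigr => M /Nsmall Md.
rewrite (bigD1 (Ordinal Md)) //= eqxx mul1r big1 ?addr0 // => k.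
by rewrite -val_eqE /= eq_sym => /negbTE ->; rewrite mul0r.
Qed.

(** The h-vector formula at index [n + 2], for any complex with a half-open
decomposition in which every [N M] has fewer than [d] elements. *)
Lemma h_number_formula n :
  \sum_(0 <= k < d) h_number k * alpha d (n.+2%:Z - k%:Z) =
  (\sum_(S in K | S != set0) 'C(n, #|S|.-1))%N%:Z.
Proof.
rewrite h_number_sum.
rewrite (eq_bigr _ (fun M Mt => esym (cell_weight_interval n (Nsmall Mt)))).
rewrite -half_open_sum (big_morph Posz PoszD (erefl _)) big_mkcondr.
by apply: eq_bigr => S _; rewrite -cards_eq0; case: #|S|.
Qed.

End HalfOpen.

(** * Faces of a finitely generated cone *)

Section Cone.
Local Open Scope set_scope.
Context (R : realType) (n m : nat) (u : 'I_m.+1 -> 'rV[R]_n).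
Local Notation I := 'I_m.+1.
Implicit Types (A B S T M : {set 'I_m.+1}) (l k : 'I_m.+1 -> R) (c x : 'rV[R]_n).

(** The linear combination of the generators with coefficients [l]. *)
Definition comb l : 'rV[R]_n := \sum_i l i *: u i.

Definition supp l : {set 'I_m.+1} := [set i | l i != 0].

(** [B] is the set of generators in [A] lying on the face of the cone over
[A] cut out by some functional that is nonpositive on [A]. *)
Definition cone_face A B : Prop :=
  exists2 c, {in A, forall i, dot (u i) c <= 0}
           & B = [set i in A | dot (u i) c == 0].

(** The faces of the cone over all generators, as sets of generators. *)
Definition faces : {set {set 'I_m.+1}} := [set B | `[< cone_face setT B >]].

(** The closed convex cone generated by [A]. *)
Definition in_cone A x := exists l, [/\ forall i, 0 <= l i, supp l \subset A & x = comb l].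

Lemma dot_comb l c : dot (comb l) c = \sum_i l i * dot (u i) c.
Proof. by rewrite dot_suml; apply: eq_bigr => i _; rewrite dotZl. Qed.

Lemma notin_supp l A i : supp l \subset A -> i \notin A -> l i = 0.
Proof.
by move=> /subsetP h; apply: contraNeq => li; apply: h; rewrite inE.
Qed.

Lemma supp_sub l A : (forall i, i \notin A -> l i = 0) -> supp l \subset A.
Proof.
move=> h; apply/subsetP => i; rewrite inE; apply: contraNT => /h ->.
by rewrite eqxx.
Qed.

Lemma comb_lin a b l k :
  comb (fun i => a * l i + b * k i) = a *: comb l + b *: comb k.
Proof.
rewrite !scaler_sumr -big_split; apply: eq_bigr => i _ /=.
by rewrite scalerDl !scalerA.
Qed.

Lemma comb_delta a : comb (fun i => (i == a)%:R) = u a.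
Proof.
rewrite /comb (bigD1 a) //= eqxx scale1r big1 ?addr0 // => i /negbTE ->.
by rewrite scale0r.
Qed.

Lemma eq_supp l k : l =1 k -> supp l = supp k.
Proof. by move=> h; apply/setP => i; rewrite !inE h. Qed.

Lemma facesP B : reflect (cone_face setT B) (B \in faces).
Proof. by rewrite inE; apply: asboolP. Qed.

Lemma cone_face_sub A B : cone_face A B -> B \subset A.
Proof. by case=> c _ ->; apply/subsetP => i; rewrite inE => /andP[]. Qed.

Lemma faces_cone_face A B : B \in faces -> B \subset A -> cone_face A B.
Proof.
move=> /facesP[c hc hB] BA; exists c => [i _|]; first exact: hc.
apply/setP => i; rewrite [in RHS]inE; have [iA|iA] /= := boolP (i \in A).
  by rewrite hB !inE.
by apply/negbTE; apply: contra iA; exact: (subsetP BA).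
Qed.

(** A face of a face is a face. *)
Lemma cone_face_trans A B : A \in faces -> cone_face A B -> B \in faces.
Proof.
move=> /facesP[c hc hA] [c' hc' ->]; apply/facesP.
(* the functional defining A dominates outside A once multiplied by M *)
pose M := 1 + \sum_(i | i \notin A) `|dot (u i) c'| / `|dot (u i) c|.
have out i : i \notin A -> dot (u i) (M *: c + c') < 0.
  move=> iA; have ci : dot (u i) c < 0.
    rewrite lt_neqAle hc ?inE // andbT; apply: contra iA.
    by rewrite hA !inE.
  have Mi : `|dot (u i) c'| / `|dot (u i) c| < M.
    rewrite /M (bigD1 i) //= addrCA ltrDl; apply: ltr_pwDl => //.
    by apply: sumr_ge0 => j _; rewrite divr_ge0.
  rewrite dotDr dotZr; move: Mi; rewrite ltr_pdivrMr ?normr_gt0 ?lt_eqF //.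
  rewrite (ltr0_norm ci); have := ler_norm (dot (u i) c'); lra.
exists (M *: c + c') => [i _|].
  have [iA|iA] := boolP (i \in A); last exact/ltW/out.
  have := iA; rewrite {1}hA !inE /= => /eqP ci.
  by rewrite dotDr dotZr ci mulr0 add0r hc'.
apply/setP => i; rewrite !inE /=; have [iA|iA] /= := boolP (i \in A).
  have := iA; rewrite {1}hA !inE /= => /eqP ci.
  by rewrite dotDr dotZr ci mulr0 add0r.
by rewrite (lt_eqF (out i iA)).
Qed.

Lemma faces_setT : setT \in faces.
Proof.
apply/facesP; exists 0 => [i _|]; first by rewrite dot0r.
by apply/setP => i; rewrite !inE dot0r eqxx.
Qed.

Lemma faces_setI A B : A \in faces -> B \in faces -> A :&: B \in faces.
Proof.
move=> /facesP[c hc hA] /facesP[c' hc' hB]; apply/facesP; exists (c + c').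
  by move=> i iT; rewrite dotDr; have := hc i iT; have := hc' i iT; lra.
apply/setP => i; rewrite hA hB !inE /= dotDr.
by rewrite naddr_eq0 ?hc ?hc' ?inE.
Qed.

Lemma in_cone_farkas A x :
  (forall c, {in A, forall i, dot (u i) c <= 0} -> dot x c <= 0) -> in_cone A x.
Proof.
move=> h; have [|l l0 ->] := @farkas _ _ _ (enum A) u x (enum_uniq _).
  by move=> c hc; apply: h => i iA; apply: hc; rewrite mem_enum.
exists (fun i => if i \in A then l i else 0); split.
- by move=> i; case: ifP => // iA; apply: l0; rewrite mem_enum.
- by apply: supp_sub => i /negbTE ->.
- rewrite big_enum big_mkcond; apply: eq_bigr => i _.
  by case: ifP => //; rewrite scale0r.
Qed.

Lemma dot_in_cone A x c :
  in_cone A x -> {in A, forall i, dot (u i) c <= 0} -> dot x c <= 0.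
Proof.
move=> [l [l0 lA ->]] hc; rewrite dot_comb; apply: sumr_le0 => i _.
have [iA|iA] := boolP (i \in A); last by rewrite (notin_supp lA iA) mul0r.
by rewrite mulr_ge0_le0 // hc.
Qed.

Lemma comb_face l c : (forall i, 0 <= l i) ->
  {in supp l, forall i, dot (u i) c <= 0} -> dot (comb l) c = 0 ->
  {in supp l, forall i, dot (u i) c = 0}.
Proof.
move=> l0 hc; rewrite dot_comb => /eqP; rewrite -oppr_eq0 -sumrN psumr_eq0.
  move=> /allP h i; rewrite inE => li; have := h i (mem_index_enum _).
  by rewrite oppr_eq0 mulf_eq0 (negbTE li) => /eqP.
move=> i _; rewrite oppr_ge0; have [li|] := boolP (i \in supp l).
  by rewrite mulr_ge0_le0 // hc.
by rewrite inE negbK => /eqP ->; rewrite mul0r.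
Qed.

Lemma comb_supp0 l c : {in supp l, forall i, dot (u i) c = 0} -> dot (comb l) c = 0.
Proof.
move=> h; rewrite dot_comb big1 // => i _; have [/h ->|] := boolP (i \in supp l).
  by rewrite mulr0.
by rewrite inE negbK => /eqP ->; rewrite mul0r.
Qed.

Variable e : 'rV[R]_n.
Hypothesis ue : forall i, dot (u i) e = 1.

Lemma faces_set0 : set0 \in faces.
Proof.
apply/facesP; exists (- e) => [i _|]; first by rewrite dotNr ue lerN10.
by apply/setP => i; rewrite !inE dotNr ue oppr_eq0 oner_eq0.
Qed.

Lemma dot_in_cone_ge0 A x : in_cone A x -> 0 <= dot x e.
Proof.
move=> /dot_in_cone h; rewrite -oppr_le0 -dotNr; apply: h => i _.
by rewrite dotNr ue lerN10.
Qed.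

(** Moving from a point of the cone over [A] in the direction opposite to the
generator [a], one leaves the cone at a point of a face that avoids [a]. The
supremum of the admissible lengths is attained by Farkas' lemma, which also
provides the face at the exit point. *)
Lemma exit_point A a l : A \in faces -> a \in A ->
  (forall i, 0 <= l i) -> supp l \subset A ->
  exists t B, [/\ 0 <= t, B \in faces, B \subset A, a \notin B &
    in_cone B (comb l - t *: u a)].
Proof.
move=> AL aA l0 lA; set x := comb l.
pose E : classical_sets.set R := fun t => in_cone A (x - t *: u a).
have E0 : E 0 by exists l; split => //; rewrite scale0r subr0.
have ubE t : E t -> t <= dot x e.
  by move=> /dot_in_cone_ge0; rewrite dotBl dotZl ue mulr1 subr_ge0.
have supE : classical_sets.has_sup E by split; [exists 0 | exists (dot x e)].
set s := sup E; have s0 : 0 <= s by apply: sup_upper_bound.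
(* the supremum is attained: a functional separating it from the cone would
   also separate the admissible lengths close to it *)
have Es : E s.
  apply: in_cone_farkas => c hc; rewrite leNgt; apply/negP => zc.
  have ac : dot (u a) c <= 0 by exact: hc.
  have r0 : 0 < 1 - dot (u a) c by rewrite subr_gt0 (le_lt_trans ac).
  have [t Et st] := sup_adherent (divr_gt0 zc r0) supE.
  have ts : t <= s by apply: sup_upper_bound.
  have := dot_in_cone Et hc; move: zc st; rewrite -/s !dotBl !dotZl.
  set X := dot x c; set Y := dot (u a) c in ac r0 *.
  move=> zc; rewrite ltrBlDr -ltrBlDl ltr_pdivlMr // => h1 h2.
  have : 0 <= (s - t) by rewrite subr_ge0.
  nra.
set z := x - s *: u a in Es.
have out t : 0 < t -> ~ in_cone A (z - t *: u a).
  move=> t0 h; have : E (s + t) by rewrite /E scalerDl opprD addrA.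
  by move=> /(sup_upper_bound supE); rewrite gerDl leNgt t0.
(* Farkas' lemma for the generators in A and - z, applied to - u a *)
have [c [hc zc ac]] : exists c, [/\ {in A, forall i, dot (u i) c <= 0},
    0 <= dot z c & dot (u a) c < 0].
  apply: contrapT => nex.
  pose u' o := if o is Some i then u i else - z.
  have [||r r0] := @farkas _ _ _ (None :: [seq Some i | i <- enum A]) u' (- u a).
  - rewrite /= map_inj_uniq ?enum_uniq ?andbT; last exact: Some_inj.
    by apply/negP => /mapP[].
  - move=> c hc; rewrite dotNl oppr_le0 leNgt; apply/negP => ac; apply: nex.
    exists c; split=> // [i iA|]; last first.
      by have := hc None (mem_head _ _); rewrite /= dotNl oppr_le0.
    by apply: (hc (Some i)); rewrite inE mem_map ?mem_enum //; exact: Some_inj.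
  rewrite big_cons big_map big_enum /=; set t := r None; set y := \sum_(i in A) _.
  move=> ey; have t0 : 0 <= t by apply: r0; exact: mem_head.
  have yA : in_cone A y.
    apply: in_cone_farkas => c hc; rewrite dot_suml; apply: sumr_le0 => i iA.
    rewrite dotZl mulr_ge0_le0 ?hc // r0 // inE mem_map ?mem_enum //.
    exact: Some_inj.
  have [t00|tn0] := eqVneq t 0.
    have := dot_in_cone_ge0 yA; have -> : y = - u a.
      by rewrite ey t00 scale0r add0r.
    by rewrite dotNl ue ler0N1.
  have tp : 0 < t^-1 by rewrite invr_gt0 lt_def tn0.
  apply: (out _ tp); apply: in_cone_farkas => c hc.
  have := dot_in_cone yA hc; have -> : y = t *: (z - t^-1 *: u a).
    rewrite scalerBr scalerA divff // scale1r; apply: (addrI (t *: - z)).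
    by rewrite -ey scalerN addrA addNr add0r.
  by rewrite dotZl pmulr_rle0 // lt_def tn0.
have zc0 : dot z c = 0 by apply/eqP; rewrite eq_le zc (dot_in_cone Es hc).
have BA : cone_face A [set i in A | dot (u i) c == 0] by exists c.
exists s, [set i in A | dot (u i) c == 0]; split => //.
- exact: cone_face_trans BA.
- exact: cone_face_sub BA.
- by rewrite inE aA lt_eqF.
- have [k [k0 kA ek]] := Es; rewrite ek; exists k; split => //.
  rewrite -/z in ek; rewrite ek in zc0.
  have kc : {in supp k, forall i, dot (u i) c <= 0}.
    by move=> i /(subsetP kA); exact: hc.
  apply/subsetP => i ik; rewrite inE (subsetP kA) //=.
  by rewrite (comb_face k0 kc zc0 ik).
Qed.

End Cone.

(** * The pulling triangulation of a cone *)

Section ConeComplex.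
Local Open Scope set_scope.
Context (R : realType) (n m : nat) (u : 'I_m.+1 -> 'rV[R]_n).
Local Notation I := 'I_m.+1.
Implicit Types (A B S T M : {set 'I_m.+1}) (l k : 'I_m.+1 -> R) (c x : 'rV[R]_n).
Variable e : 'rV[R]_n.
Hypothesis ue : forall i, dot (u i) e = 1.
Local Notation K := (pulling_complex (faces u)).
Local Notation cl := (closure_of (faces u)).
Local Notation comb := (comb u).
Let LT := faces_setT u.
Let L0 := faces_set0 ue.
Let LI := @faces_setI _ _ _ u.

(** Linear independence of the generators indexed by [A]. *)
Definition free_on A := forall l, supp l \subset A -> comb l = 0 -> forall i, l i = 0.

Lemma pulling_free S : S \in K -> free_on S.
Proof.
move=> SK l lS cl0; have lK := pulling_sub SK lS.
suff l0 : supp l = set0.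
  by move=> i; apply: (@notin_supp _ _ _ (supp l)) => //; rewrite l0 inE.
apply/eqP; apply: contraT => l0; set a := apex (cl (supp l)).
have al : a \in supp l by move/pullingP: lK => /(_ _ (subxx _) l0).
have aN : a \notin cl (supp l :\ a).
  by rewrite (pulling_apex L0 (closure_in LT LI _) (pulling_sub lK _)) ?setD11
    ?subD1set // (subset_trans (subD1set _ _)) ?sub_closure.
have /facesP[c hc hcl] := closure_in LT LI (supp l :\ a).
have ca : dot (u a) c != 0 by move: aN; rewrite hcl !inE.
have : dot (comb l) c = 0 by rewrite cl0 dot0l.
rewrite dot_comb (bigD1 a) //= big1 ?addr0.
  by move/eqP; rewrite mulf_eq0 (negbTE ca) orbF; move: al; rewrite inE => /negbTE ->.
move=> i ia; have [il|] := boolP (i \in supp l); last first.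
  by rewrite inE negbK => /eqP ->; rewrite mul0r.
have : i \in cl (supp l :\ a) by apply: (subsetP (sub_closure _ _)); rewrite in_setD1 ia.
by rewrite hcl !inE => /eqP ->; rewrite mulr0.
Qed.

Lemma closure_supp_sub l k : (forall i, 0 <= l i) -> (forall i, 0 <= k i) ->
  comb l = comb k -> cl (supp k) \subset cl (supp l).
Proof.
move=> l0 k0 lk; apply: closure_sub; first exact: closure_in.
have /facesP[c hc hcl] := closure_in LT LI (supp l).
have kc := comb_face k0 (fun i _ => hc i (in_setT i)) _.
apply/subsetP => i ik; rewrite hcl !inE; apply/eqP/kc => //.
rewrite -lk; apply: comb_supp0 => j /(subsetP (sub_closure (faces u) _)).
by rewrite hcl !inE => /eqP.
Qed.


(** Every vector has at most one representation with nonnegative coefficients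
whose support is in the pulling complex. Two representations have supports
with the same closure, hence share its apex, and the smaller of the two apex
coefficients can be subtracted from both. *)
Lemma pulling_unique l k : (forall i, 0 <= l i) -> (forall i, 0 <= k i) ->
  supp l \in K -> supp k \in K -> comb l = comb k -> l =1 k.
Proof.
have [N] := ubnP (#|supp l| + #|supp k|); elim: N => // N IH in l k *.
move=> ltN l0 k0 lK kK lk.
wlog lka : l k ltN l0 k0 lK kK lk / l (apex (cl (supp l))) <= k (apex (cl (supp l))).
  move=> W; have [|/ltW h] := leP (l (apex (cl (supp l)))) (k (apex (cl (supp l)))).
    exact: W.
  have ekl : cl (supp k) = cl (supp l).
    by apply/eqP; rewrite eqEsubset !closure_supp_sub.
  move=> i; apply/esym; move: i; apply: W => //; first by rewrite addnC.
  by rewrite ekl.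
have ekl : cl (supp k) = cl (supp l).
  by apply/eqP; rewrite eqEsubset !closure_supp_sub.
have [s0|s0] := eqVneq (supp l) set0.
  have t0 : supp k = set0.
    by apply/eqP; rewrite -(closure_eq0 L0) ekl (closure_eq0 L0) s0.
  by move=> i; rewrite (@notin_supp _ _ l set0) ?s0 ?inE // (@notin_supp _ _ k set0)
    ?t0 ?inE.
have t0 : supp k != set0 by rewrite -(closure_eq0 L0) ekl (closure_eq0 L0).
set a := apex (cl (supp l)) in lka.
have al : a \in supp l by move/pullingP: (lK) => /(_ _ (subxx _) s0).
have ak : a \in supp k by rewrite /a -ekl; move/pullingP: (kK) => /(_ _ (subxx _) t0).
pose l' i := 1 * l i + (- l a) * (i == a)%:R.
pose k' i := 1 * k i + (- l a) * (i == a)%:R.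
have sl' : supp l' \subset supp l :\ a.
  apply: supp_sub => i; rewrite !inE negb_and !negbK /l' => /orP[/eqP ->|/eqP li].
    by rewrite eqxx /=; ring.
  by rewrite li; case: eqP => [<-|_] /=; rewrite ?li; ring.
have sk' : supp k' \subset supp k.
  apply: supp_sub => i ik; rewrite /k' (notin_supp _ ik) //.
  by case: eqP ik => [->|_ _]; [rewrite ak | rewrite /=; ring].
have h : l' =1 k'.
  apply: IH => [|i|i|||].
  - move: ltN; rewrite (cardsD1 a (supp l)) al add1n addSn ltnS.
    by apply: leq_ltn_trans; rewrite leq_add ?subset_leq_card.
  - rewrite /l'; case: eqP => [->|_]; first by rewrite mulr1; lra.
    by rewrite mulr0 addr0 mul1r.
  - rewrite /k'; case: eqP => [->|_]; first by rewrite mulr1; lra.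
    by rewrite mulr0 addr0 mul1r.
  - exact: pulling_sub (subset_trans sl' (subD1set _ _)).
  - exact: pulling_sub sk'.
  - by rewrite /l' /k' !comb_lin lk.
by move=> i; have := h i; rewrite /l' /k'; lra.
Qed.

(** Every vector of the cone over a face has a representation with support in
the pulling complex. *)
Lemma pulling_cover A l : A \in faces u -> (forall i, 0 <= l i) -> supp l \subset A ->
  exists k, [/\ forall i, 0 <= k i, supp k \in K, supp k \subset A & comb k = comb l].
Proof.
have [N] := ubnP #|A|; elim: N => // N IH in A l *.
move=> ltN AL l0 lA; have [A0|A0] := eqVneq A set0.
  exists l; split => //; suff -> : supp l = set0 by apply: pulling0.
  by apply/eqP; rewrite -subset0 -A0.
set a := apex A; have aA : a \in A by exact: apex_in.
have [t [B [t0 BL BA aB [k [k0 kB ek]]]]] := exit_point ue AL aA l0 lA.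
have ltBA : (#|B| < #|A|)%N by apply/proper_card/properP; split => //; exists a.
have ltBN : (#|B| < N)%N by rewrite (leq_trans ltBA) // -ltnS.
have [k' [k'0 k'K k'B ek']] := IH B k ltBN BL k0 kB.
have k'A := subset_trans k'B BA.
pose f i := t * (i == a)%:R + 1 * k' i.
have ska : supp f \subset a |: supp k'.
  apply: supp_sub => i; rewrite !inE negb_or negbK /f => /andP[/negbTE -> /eqP ->].
  by rewrite !mulr0 addr0.
exists f; split.
- by move=> i; rewrite /f addr_ge0 ?mulr_ge0.
- exact: pulling_sub (pulling_cone AL A0 k'K k'A) ska.
- by apply: subset_trans ska _; rewrite subUset sub1set aA.
- by rewrite /f comb_lin comb_delta scale1r ek' -ek addrC subrK.
Qed.

(** The matrix whose rows are the generators, those outside [A] being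
replaced by 0, so that its row space is the span of [A]. *)
Definition masked A : 'M[R]_(m.+1, n) := \matrix_i (if i \in A then u i else 0).

(** The dimension of the span of [A]. *)
Definition rk A := \rank (masked A).

Lemma dot_mx x c : (x *m c^T) 0 0 = dot x c.
Proof. by rewrite mxE; apply: eq_bigr => i _; rewrite mxE mulrC. Qed.

Lemma row_masked A i : row i (masked A) = if i \in A then u i else 0.
Proof. by rewrite rowK. Qed.

Lemma masked_sub A B : A \subset B -> (masked A <= masked B)%MS.
Proof.
move=> AB; apply/row_subP => i; rewrite row_masked; case: ifP => iA.
  have -> : u i = row i (masked B) by rewrite row_masked (subsetP AB).
  exact: row_sub.
exact: sub0mx.
Qed.

Lemma rk_mono A B : A \subset B -> (rk A <= rk B)%N.
Proof. by move=> /masked_sub /mxrankS. Qed.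

Lemma comb_sub A l : supp l \subset A -> (comb l <= masked A)%MS.
Proof.
move=> lA; apply: summx_sub => i _; have [iA|iA] := boolP (i \in A).
  have -> : u i = row i (masked A) by rewrite row_masked iA.
  by rewrite scalemx_sub // row_sub.
by rewrite (notin_supp lA iA) scale0r sub0mx.
Qed.

Lemma sub_comb A x : (x <= masked A)%MS -> exists2 l, supp l \subset A & x = comb l.
Proof.
case/submxP => r ->; exists (fun i => if i \in A then r 0 i else 0).
  by apply: supp_sub => i /negbTE ->.
rewrite mulmx_sum_row; apply: eq_bigr => i _; rewrite row_masked.
by case: ifP => _; rewrite ?scaler0 ?scale0r.
Qed.

Lemma rk_le_card A : (rk A <= #|A|)%N.
Proof.
pose U : 'M_(#|A|, n) := \matrix_j u (enum_val j).
apply: leq_trans (rank_leq_row U); apply/mxrankS/row_subP => i.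
rewrite row_masked; case: ifP => iA; last exact: sub0mx.
have -> : u i = row (enum_rank_in iA i) U by rewrite rowK enum_rankK_in.
exact: row_sub.
Qed.

Lemma rk_free A : free_on A -> rk A = #|A|.
Proof.
move=> fA; pose U : 'M_(#|A|, n) := \matrix_j u (enum_val j).
have rU : row_free U.
  apply: inj_row_free => v; rewrite mulmx_sum_row => v0.
  pose l i := if [pick j | enum_val j == i] is Some j then v 0 j else 0.
  have lE j : l (enum_val j) = v 0 j.
    rewrite /l; case: pickP => [j' /eqP /enum_val_inj -> //|/(_ j)].
    by rewrite eqxx.
  have lA : supp l \subset A.
    apply: supp_sub => i iA; rewrite /l; case: pickP => // j /eqP ji.
    by rewrite -ji enum_valP in iA.
  have cl0 : comb l = 0.
    rewrite -v0 /comb (bigID (mem A)) /= [X in _ + X]big1 ?addr0; last first.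
      by move=> i /(notin_supp lA) ->; rewrite scale0r.
    rewrite (big_enum_val (fun i => l i *: u i)) /=.
    by apply: eq_bigr => j _; rewrite lE rowK.
  by apply/rowP => j; rewrite -lE (fA _ lA cl0) mxE.
apply/eqP; rewrite eqn_leq rk_le_card /=; move: rU; rewrite /row_free => /eqP <-.
apply/mxrankS/row_subP => j; rewrite rowK.
have -> : u (enum_val j) = row (enum_val j) (masked A) by rewrite row_masked enum_valP.
exact: row_sub.
Qed.

Lemma rk_separate A B : (rk A < rk B)%N ->
  exists2 c, {in A, forall i, dot (u i) c = 0} & exists2 j, j \in B & dot (u j) c != 0.
Proof.
move=> lt; apply: contrapT => nex; move: lt; rewrite ltnNge => /negP; apply.
apply/mxrankS; rewrite submxE; apply/eqP/matrixP => i j; rewrite [RHS]mxE.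
apply: contrapT => /eqP h; apply: nex.
have E (s : I) B' : dot (row s (masked B')) (col j (cokermx (masked A)))^T =
    (masked B' *m cokermx (masked A)) s j.
  rewrite -dot_mx trmxK !mxE; apply: eq_bigr => t _; congr (_ * _).
    by rewrite row_masked mxE.
  by rewrite mxE.
have iB : i \in B.
  by apply: contraNT h => iB; rewrite -E row_masked (negbTE iB) dot0l.
exists (col j (cokermx (masked A)))^T; last first.
  by exists i => //; have := E i B; rewrite row_masked iB => ->.
by move=> s sA; have := E s A; rewrite row_masked sA mulmx_coker mxE.
Qed.

(** A subset of a linearly independent set spans a face of its cone. *)
Lemma pulling_cone_face S B : S \in K -> B \subset S -> cone_face u S B.
Proof.
move=> SK BS.
have /choice[c hc] t : exists c, t \in S -> {in S :\ t, forall i, dot (u i) c = 0} /\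
    dot (u t) c < 0.
  have [tS|tS] := boolP (t \in S); last by exists 0.
  have [|c c0 [j jS cj]] := @rk_separate (S :\ t) S.
    have StK := pulling_sub SK (subD1set S t).
    by rewrite !rk_free; do ?exact: pulling_free; rewrite (cardsD1 t S) tS.
  have jt : j = t.
    by apply: contraNeq cj => jt; rewrite c0 // in_setD1 jt.
  move: cj; rewrite jt => /lt_total/orP[ct|ct]; first by exists c.
  by exists (- c) => _; split=> [i /c0|]; rewrite dotNr ?oppr_lt0 // => ->; rewrite oppr0.
have cE i : i \in S -> dot (u i) (\sum_(t in S :\: B) c t) =
    if i \in B then 0 else dot (u i) (c i).
  move=> iS; rewrite dotC dot_suml; case: ifP => iB.
    apply: big1 => t; rewrite in_setD => /andP[tB tS]; rewrite dotC.
    by apply: (hc t tS).1; rewrite in_setD1 iS andbT; apply: contraNneq tB => <-.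
  rewrite (bigD1 i) /= ?in_setD ?iB // dotC big1 ?addr0 // => t /andP[].
  rewrite in_setD => /andP[_ tS] ti; rewrite dotC; apply: (hc t tS).1.
  by rewrite in_setD1 iS eq_sym ti.
exists (\sum_(t in S :\: B) c t) => [i iS|].
  by rewrite cE //; case: ifP => // _; exact/ltW/(hc i iS).2.
apply/setP => i; rewrite !inE; have [iS|iS] /= := boolP (i \in S); last first.
  by apply: contraNF iS; exact: (subsetP BS).
by rewrite cE //; case: ifP => _; rewrite ?eqxx // lt_eqF //; exact: (hc i iS).2.
Qed.

End ConeComplex.

(** * The half-open decomposition at a generic point *)

Lemma poly_nonroot (R : numDomainType) (p : {poly R}) :
  p != 0 -> exists k : nat, p.[k.+1%:R] != 0.
Proof.
move=> p0; apply: contrapT => /forallNP h.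
have := @max_poly_roots _ p [seq i.+1%:R | i <- iota 0 (size p)] p0.
rewrite size_map size_iota ltnn => W; apply: notF; apply: W.
  by apply/allP => _ /mapP[k _ ->]; apply: contrapT => /negP; exact: h.
rewrite map_inj_uniq ?iota_uniq // => i j /eqP.
by rewrite eqr_nat eqSS => /eqP.
Qed.

Lemma pigeonhole_nat (T : finType) (Q : nat -> T -> Prop) :
  (forall k, exists t, Q k t) -> exists t, forall k0, exists2 k, (k0 <= k)%N & Q k t.
Proof.
move=> h; apply: contrapT => /forallNP nh.
have /choice[b hb] t : exists b, forall k, (b <= k)%N -> ~ Q k t.
  have /existsNP[k0 hk] := nh t; exists k0 => k k0k Qk; apply: hk.
  by exists k.
have [t Qt] := h (\max_t b t); exact: hb (leq_bigmax t) Qt.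
Qed.

Section Cells.
Local Open Scope set_scope.
Context (R : realType) (n m d : nat) (u : 'I_m.+1 -> 'rV[R]_n).
Local Notation I := 'I_m.+1.
Implicit Types (A B S T M : {set 'I_m.+1}) (l k : 'I_m.+1 -> R) (c x : 'rV[R]_n).
Variable e : 'rV[R]_n.
Hypothesis ue : forall i, dot (u i) e = 1.
Hypothesis vertices : forall i, [set i] \in faces u.
Hypothesis rkT : rk u setT = d.+1.
Hypothesis d_gt0 : (0 < d)%N.
Local Notation K := (pulling_complex (faces u)).
Local Notation comb := (comb u).
Local Notation top := [set M in K | #|M| == d.+1].

Lemma top_span M l : M \in top ->
  exists k, supp k \subset M /\ comb k = comb l.
Proof.
rewrite inE => /andP[MK /eqP Md].
have MT : (masked u setT <= masked u M)%MS.
  rewrite -(mxrank_leqif_sup (masked_sub u (finset.subsetT M))).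
  by have := rk_free (pulling_free ue MK); rewrite Md -rkT /rk => ->.
have := submx_trans (comb_sub u (finset.subsetT (supp l))) MT.
by case/sub_comb => k kM ek; exists k.
Qed.

Lemma pulling_card S : S \in K -> (#|S| <= d.+1)%N.
Proof.
by move=> SK; rewrite -(rk_free (pulling_free ue SK)) -rkT rk_mono // finset.subsetT.
Qed.

Lemma top_apex M A : M \in top -> A \in faces u -> A != set0 -> M \subset A ->
  apex A \in M.
Proof.
rewrite inE => /andP[MK /eqP Md] AL A0 MA.
apply: contraT => aM; have := pulling_card (pulling_cone AL A0 MK MA).
by rewrite cardsU1 aM Md add1n ltnn.
Qed.

(** A positive combination of the generators outside the span of every set of
the complex with at most [d] elements. *)
Lemma generic_point : exists l0 : I -> R, (forall i, 0 < l0 i) /\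
  forall S, S \in K -> (#|S| <= d)%N -> forall k, supp k \subset S ->
  comb k <> comb l0.
Proof.
have /choice[c hc] S : exists c, S \in K -> (#|S| <= d)%N ->
    {in S, forall i, dot (u i) c = 0} /\ exists2 j, j \in setT & dot (u j) c != 0.
  have [Sd|Sd] := leqP #|S| d; last by exists 0.
  have [|c hc hj] := @rk_separate _ _ _ u S setT; last by exists c.
  by rewrite rkT ltnS (leq_trans (rk_le_card u S)).
(* the points sum_i t ^ i u_i avoid a proper subspace for all but finitely
   many t *)
pose p S := \poly_(i < m.+1) dot (u (inord i)) (c S).
have [|k] := @poly_nonroot _ (\prod_(S in K | (#|S| <= d)%N) p S).
  apply/prodf_neq0 => S /andP[SK Sd]; have [_ [j _ hj]] := hc S SK Sd.
  apply: contra hj => /eqP pS;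
  have := congr1 (fun q : {poly R} => q`_j) pS.
  by rewrite /p coef_poly ltn_ord inord_val coef0 => ->.
set t := k.+1%:R; rewrite horner_prod => /prodf_neq0 ht.
exists (fun i => t ^+ i); split => [i|S SK Sd r rS er]; first by rewrite exprn_gt0 // ltr0n.
have := ht S; rewrite SK Sd => /(_ isT) /negP; apply.
have [cS _] := hc S SK Sd; apply/eqP.
transitivity (dot (comb (fun i : I => t ^+ i)) (c S)); last first.
  by rewrite -er; apply: comb_supp0 => i /(subsetP rS); exact: cS.
rewrite /p horner_poly dot_comb; apply: eq_bigr => i _.
by rewrite inord_val mulrC.
Qed.

(** The half-open decomposition of the pulling complex at a generic point:
the [N M] constructed is the set of generators in [M] whose coefficient at that point is
nonpositive. *)
Lemma half_open_cells : exists N : {set I} -> {set I},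
  [/\ forall S, S \in K ->
        exists2 M, M \in top & (N M \subset S) && (S \subset M),
      forall S M M', S \in K -> M \in top -> M' \in top ->
        (N M \subset S) && (S \subset M) -> (N M' \subset S) && (S \subset M') ->
        M = M',
      forall M, M \in top -> N M \subset M &
      forall M, M \in top -> (#|N M| < d)%N].
Proof.
have [l0 [l0p gen]] := generic_point.
have /choice[q hq] M : exists k, M \in top -> supp k \subset M /\ comb k = comb l0.
  have [Mt|Mt] := boolP (M \in top); last by exists (fun=> 0).
  by have [k hk] := top_span l0 Mt; exists k.
pose ones S i : R := (i \in S)%:R.
have onesS S : supp (ones S) = S.
  by apply/setP => i; rewrite inE /ones pnatr_eq0 eqb0 negbK.
exists (fun M => [set i in M | q M i <= 0]); split.
- move=> S SK.
  (* points of the path from the barycentre of S towards the generic point,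
     scaled so that the generic point has coefficient 1; one simplex M
     contains points of the path arbitrarily close to S *)
  have path (k : nat) : exists S', S' \in K /\ exists r : I -> R,
      [/\ forall i, 0 <= r i, supp r = S' & comb r = k%:R *: comb (ones S) + comb l0].
    pose w i := k%:R * ones S i + 1 * l0 i.
    have w0 i : 0 <= w i by rewrite /w addr_ge0 ?mulr_ge0 ?ler0n // ltW.
    have [r [r0 rK _ er]] := pulling_cover ue (faces_setT u) w0 (finset.subsetT _).
    exists (supp r); split => //; exists r; split => //.
    by rewrite er comb_lin scale1r.
  have [M hM] := pigeonhole_nat path.
  have MK : M \in K by have [k _ []] := hM 0%N.
  have Mtop : M \in top.
    rewrite inE MK eqn_leq pulling_card //= ltnNge; apply/negP => Md.
    have [k1 _ [_ [r1 [_ s1 e1]]]] := hM 0%N.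
    have [k2 k12 [_ [r2 [_ s2 e2]]]] := hM k1.+1.
    (* the generic point is a combination of two points of the path, so it would
       lie in the span of M *)
    pose D : R := k2%:R - k1%:R.
    have D0 : D != 0 by rewrite subr_eq0 eqr_nat gtn_eqF.
    pose r i := (k2%:R / D) * r1 i + (- k1%:R / D) * r2 i.
    apply: (gen M MK Md r); first apply: supp_sub => i iM.
      have h1 : r1 i = 0 by apply: (@notin_supp _ _ _ M); rewrite ?s1.
      have h2 : r2 i = 0 by apply: (@notin_supp _ _ _ M); rewrite ?s2.
      by rewrite /r h1 h2 !mulr0 addr0.
    rewrite /r comb_lin e1 e2 !scalerDr !scalerA addrACA -!scalerDl.
    have -> : k2%:R / D * k1%:R + - k1%:R / D * k2%:R = 0 :> R by field.
    have -> : k2%:R / D + - k1%:R / D = 1 :> R by rewrite /D; field.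
    by rewrite scale0r add0r scale1r.
  have [qM eq] := hq M Mtop.
  have [b [bM eb]] := top_span (ones S) Mtop.
  have rE (k : nat) r : supp r = M -> comb r = k%:R *: comb (ones S) + comb l0 ->
      forall i, r i = k%:R * b i + q M i.
    move=> sr er i; apply/eqP; rewrite -subr_eq0; apply/eqP.
    pose f i := 1 * r i + (-1) * (k%:R * b i + 1 * q M i).
    have : f i = 0; last by rewrite /f; lra.
    apply: (pulling_free ue MK).
      apply: supp_sub => j jM; rewrite /f (@notin_supp _ _ r M) ?sr //.
      by rewrite (notin_supp bM) // (notin_supp qM) //; lra.
    rewrite /f comb_lin (comb_lin _ _ _ b) er eb eq !scale1r scaleN1r subrr //.
  have pos i : i \in M -> forall k0 : nat, exists2 k : nat, (k0 <= k)%N & 0 < k%:R * b i + q M i.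
    move=> iM k0; have [k k0k [_ [r [r0 sr er]]]] := hM k0; exists k => //.
    rewrite -(rE _ _ sr er) lt_def r0 andbT.
    by move: iM; rewrite -sr inE.
  have b0 i : 0 <= b i.
    have [iM|iM] := boolP (i \in M); last by rewrite (notin_supp bM).
    rewrite leNgt; apply/negP => bi.
    have [k0 hk0] : exists k0 : nat, q M i / - b i < k0%:R.
      by exists (Num.truncn (q M i / - b i)).+1; exact: truncnS_gt.
    have [k k0k] := pos i iM k0; rewrite ltr_pdivrMr ?oppr_gt0 // in hk0.
    have : k0%:R <= k%:R :> R by rewrite ler_nat.
    nra.
  (* b represents the barycentre of S in the closed simplex M, and such a
     representation is unique *)
  have bE : b =1 ones S.
    apply: (pulling_unique ue) => //.
      exact: pulling_sub MK bM.
    by rewrite onesS.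
  exists M => //; apply/andP; split; last first.
    by rewrite -(onesS S) -(eq_supp bE).
  apply/subsetP => i; rewrite inE => /andP[iM qi].
  have [k _] := pos i iM 0%N; rewrite bE /ones.
  by case: (i \in S) => //; rewrite mulr0 add0r ltNge qi.
- move=> S M M' SK Mt M't.
  have big A : A \in top -> ([set i in A | q A i <= 0] \subset S) && (S \subset A) ->
     exists k0 : nat, forall k : nat, (k0 <= k)%N -> exists r : I -> R,
      [/\ forall i, 0 <= r i, supp r = A & comb r = k%:R *: comb (ones S) + comb l0].
    move=> At /andP[/subsetP NS /subsetP SA]; have [qA eqA] := hq A At.
    exists (Num.truncn (\sum_i `|q A i|)).+1 => k hk.
    have kq i : 0 < k%:R + q A i.
      have h1 : \sum_i `|q A i| < k%:R :> R.
        by apply: lt_le_trans (truncnS_gt _) _; rewrite ler_nat.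
      have h2 : `|q A i| <= \sum_i `|q A i|.
        by rewrite (bigD1 i) //= lerDl; apply: sumr_ge0.
      by have := ler_norm (- q A i); rewrite normrN; lra.
    pose r i := k%:R * ones S i + 1 * q A i.
    have rA i : i \in A -> 0 < r i.
      move=> iA; rewrite /r /ones mul1r; have [iS|iS] := boolP (i \in S).
        by rewrite mulr1.
      rewrite mulr0 add0r ltNge; apply: contra iS => qi; apply: NS.
      by rewrite inE iA.
    have rNA i : i \notin A -> r i = 0.
      move=> iA; rewrite /r /ones (notin_supp qA) // mulr0 addr0.
      by rewrite (negbTE (contra (SA i) iA)) mulr0.
    exists r; split; last by rewrite /r comb_lin eqA scale1r.
      by move=> i; have [/rA/ltW|/rNA ->] := boolP (i \in A).
    apply/setP => i; rewrite inE; have [/rA/gt_eqF ->|/rNA ->] // := boolP (i \in A).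
    by rewrite eqxx.
  move=> /(big _ Mt)[k1 h1] /(big _ M't)[k2 h2].
  have [r1 [r10 s1 e1]] := h1 (maxn k1 k2) (leq_maxl _ _).
  have [r2 [r20 s2 e2]] := h2 (maxn k1 k2) (leq_maxr _ _).
  rewrite -s1 -s2; apply/eq_supp/(pulling_unique ue) => //.
  + by move: Mt; rewrite s1 inE => /andP[].
  + by move: M't; rewrite s2 inE => /andP[].
  + by rewrite e1 e2.
- by move=> M _; apply/subsetP => i; rewrite inE => /andP[].
- move=> M Mt; set NM := [set i in M | _].
  have [qM eq] := hq M Mt.
  have T0 : [set: I] != set0 by apply/set0Pn; exists ord0; rewrite inE.
  set a := apex [set: I].
  have aM : a \in M by apply: top_apex Mt (faces_setT u) T0 (finset.subsetT M).
  have /andP[MK /eqP Md] : (M \in K) && (#|M| == d.+1) by move: Mt; rewrite inE.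
  (* M minus the apex lies in a face that avoids the apex *)
  have qa : 0 < q M a.
    have L0 := faces_set0 ue.
    have MaK : M :\ a \in K by exact: pulling_sub MK (subD1set _ _).
    have := pulling_apex L0 (faces_setT u) MaK (finset.subsetT _).
    rewrite -/a setD11; have /facesP[c hc hcl] :=
      closure_in (faces_setT u) (@faces_setI _ _ _ u) (M :\ a).
    rewrite hcl !inE => /negbT /= ca.
    have ca0 : dot (u a) c < 0 by rewrite lt_neqAle ca hc ?inE.
    have : dot (comb l0) c < 0.
      rewrite dot_comb (bigD1 a) //=; apply: ltr_wnDr.
        by apply: sumr_le0 => i _; rewrite mulr_ge0_le0 ?hc ?inE // ltW.
      by rewrite nmulr_llt0.
    rewrite -eq dot_comb (bigD1 a) //= big1 ?addr0.
      by rewrite nmulr_llt0.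
    move=> i ia; have [iM|iM] := boolP (i \in M); last by rewrite (notin_supp qM) ?mul0r.
    have : i \in closure_of (faces u) (M :\ a).
      by apply: (subsetP (sub_closure _ _)); rewrite in_setD1 ia.
    by rewrite hcl !inE => /eqP ->; rewrite mulr0.
  have NMa : NM \subset M :\ a.
    apply/subsetP => i; rewrite !inE => /andP[-> qi]; rewrite andbT.
    by apply: contraTneq qi => ->; rewrite -ltNge.
  have Mad : #|M :\ a| = d by move: Md; rewrite (cardsD1 a) aM add1n => -[].
  rewrite ltn_neqAle -{2}Mad subset_leq_card // andbT -{1}Mad.
  apply/negP => /eqP cN.
  have NE : NM = M :\ a by apply/eqP; rewrite eqEcard NMa cN leqnn.
  (* otherwise the apex would not be a vertex *)
  have /facesP[c hc hac] := vertices a.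
  have ca : dot (u a) c = 0.
    by have := set11 a; rewrite hac !inE => /eqP.
  have cneg i : i != a -> dot (u i) c < 0.
    move=> ia; rewrite lt_neqAle hc ?inE // andbT; apply: contraNneq ia => ci.
    by rewrite -in_set1 hac !inE ci eqxx.
  have [j ja] : exists j, j \in M :\ a by apply/set0Pn; rewrite -card_gt0 Mad.
  have ja' : j != a by move: ja; rewrite in_setD1 => /andP[].
  have : dot (comb l0) c < 0.
    rewrite dot_comb (bigD1 j) //=; apply: ltr_wnDr.
      by apply: sumr_le0 => i _; rewrite mulr_ge0_le0 ?hc ?inE // ltW.
    by rewrite pmulr_rlt0 ?cneg.
  apply/negP; rewrite -leNgt -eq dot_comb; apply: sumr_ge0 => i _.
  have [->|ia] := eqVneq i a; first by rewrite ca mulr0.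
  have [iM|iM] := boolP (i \in M); last by rewrite (notin_supp qM) ?mul0r.
  have : i \in NM by rewrite NE in_setD1 ia.
  by rewrite inE => /andP[_ qi]; rewrite mulr_le0 // ltW // cneg.
Qed.

End Cells.

(** * Convex hulls as sections of cones *)

From mathcomp Require Import classical_sets cardinality fsbigop convex.
From mathcomp Require Import interval_inference.

Section Homogenization.
Context (R : realType) (N : nat).
Implicit Types (x y c : 'rV[R]_N).

(** The homogenization of a point, with first coordinate 1. *)
Definition homog x : 'rV[R]_(1 + N) := row_mx (const_mx 1) x.

(** The functional equal to 1 on all homogenized points. *)
Definition height : 'rV[R]_(1 + N) := row_mx (const_mx 1) 0.

Lemma dot_row_mx (a b : R) x c :
  dot (row_mx (const_mx a) x : 'rV_(1 + N)) (row_mx (const_mx b) c) = a * b + dot x c.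
Proof.
rewrite /dot big_split_ord big_ord1 /= !row_mxEl !mxE mulrC; congr (_ + _).
by apply: eq_bigr => i _; rewrite !row_mxEr.
Qed.

Lemma dot_height x : dot (homog x) height = 1.
Proof. by rewrite dot_row_mx dot0r addr0 mulr1. Qed.

Lemma row_mx_const (c : 'rV[R]_(1 + N)) :
  c = row_mx (const_mx (c 0 (lshift N 0))) (rsubmx c).
Proof.
rewrite -{1}(hsubmxK c); congr row_mx; apply/rowP => i.
by rewrite !mxE (ord1 i).
Qed.

Lemma dot_homog x (c : 'rV[R]_(1 + N)) :
  dot (homog x) c = c 0 (lshift N 0) + dot x (rsubmx c).
Proof. by rewrite {1}(row_mx_const c) dot_row_mx mul1r. Qed.

Lemma homog_inj : injective homog.
Proof. by move=> x y /eq_row_mx[]. Qed.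

Lemma homog_conv (a b : R) x y : a + b = 1 ->
  homog (a *: x + b *: y) = a *: homog x + b *: homog y.
Proof.
move=> ab; rewrite /homog !scale_row_mx add_row_mx; congr row_mx.
by apply/matrixP => i j; rewrite !mxE !mulr1 ab.
Qed.

Lemma free_coefP (V : vectType R) (s : seq V) :
  free s <-> forall k : nat -> R, \sum_(i < size s) k i *: s`_i = 0 ->
    forall i, (i < size s)%N -> k i = 0.
Proof.
split=> [/(@freeP _ _ _ (in_tuple s)) h k k0 i si|h].
  exact: (h (fun i => k i) k0 (Ordinal si)).
apply/(@freeP _ _ _ (in_tuple s)) => k k0 i.
have E (j : 'I_(size s)) : (if insub (val j) is Some j' then k j' else 0) = k j.
  by rewrite valK.
rewrite -E; apply: (h (fun j => if insub j is Some j' then k j' else 0)).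
  by under eq_bigr do rewrite E.
exact: ltn_ord.
Qed.

Lemma sum_homog0 n (k : nat -> R) (x : nat -> 'rV[R]_N) :
  \sum_(i < n) k i *: homog (x i) = 0 <->
  \sum_(i < n) k i = 0 /\ \sum_(i < n) k i *: x i = 0.
Proof.
have -> : \sum_(i < n) k i *: homog (x i) =
    row_mx (const_mx (\sum_(i < n) k i)) (\sum_(i < n) k i *: x i).
  elim: n => [|n IH]; first by rewrite !big_ord0 row_mx0.
  rewrite !big_ord_recr /= IH scale_row_mx add_row_mx; congr row_mx.
  by apply/matrixP => i j; rewrite !mxE mulr1.
split=> [/eqP|[-> ->]]; last by rewrite row_mx0.
rewrite row_mx_eq0 => /andP[/eqP h /eqP ->]; split => //.
by have := congr1 (fun M : 'rV_1 => M 0 0) h; rewrite !mxE.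
Qed.

(** Affine independence is linear independence after homogenization. *)
Lemma aff_indepE (s : seq 'rV[R]_N) : aff_indep s = free [seq homog x | x <- s].
Proof.
case: s => [|x t]; first by rewrite /= nil_free.
have nthE (i : nat) : (i < size (x :: t))%N ->
    [seq homog x | x <- x :: t]`_i = homog (nth x (x :: t) i).
  by move=> it; rewrite (nth_map x).
have nthB (i : nat) : (i < size t)%N -> [seq y - x | y <- t]`_i = nth x t i - x.
  by move=> it; rewrite (nth_map x).
have sumB (k : nat -> R) : \sum_(i < size [seq y - x | y <- t]) k i *: [seq y - x | y <- t]`_i =
   \sum_(i < size t) k i *: nth x t i - (\sum_(i < size t) k i) *: x.
  rewrite size_map scaler_suml -sumrB; apply: eq_bigr => i _.
  by rewrite nthB // scalerBr.
have sumL (k : nat -> R) : \sum_(i < size [seq homog x | x <- x :: t])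
    k i *: [seq homog x | x <- x :: t]`_i = \sum_(i < (size t).+1) k i *: homog (nth x (x :: t) i).
  by rewrite size_map; apply: eq_bigr => i _; rewrite nthE.
apply/idP/idP => [/free_coefP h|/free_coefP h]; apply/free_coefP => k.
  rewrite sumL sum_homog0 !big_ord_recl /= => -[k0 kx].
  have hk := h (fun i => k i.+1).
  have {}hk : forall i, (i < size t)%N -> k i.+1 = 0.
    rewrite size_map in hk *; apply: hk; rewrite -(size_map (fun y => y - x) t).
    rewrite (sumB (fun i => k i.+1)); move: kx; rewrite addrC => /eqP.
    rewrite addr_eq0 => /eqP ->; rewrite -opprD -scalerDl.
    by rewrite -[_ + _]/(k 0%N + \sum_(i < size t) k i.+1) k0 scale0r oppr0.
  rewrite size_map => -[_|i it]; last exact: hk.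
  by move: k0; rewrite big1 ?addr0 // => i _; exact: hk.
rewrite sumB => k0.
pose k' i := if i is j.+1 then k j else - \sum_(i < size t) k i.
have hk : \sum_(i < size [seq homog x | x <- x :: t])
    k' i *: [seq homog x | x <- x :: t]`_i = 0.
  rewrite sumL sum_homog0 !big_ord_recl /= addNr; split => //.
  by rewrite scaleNr addrC.
rewrite size_map => i it; apply: (h k' hk i.+1).
by rewrite size_map.
Qed.

Lemma free_mx n (s : seq 'rV[R]_n) : free s = row_free (\matrix_(i < size s) s`_i).
Proof.
apply/idP/idP => [/(@freeP _ _ _ (in_tuple s)) h|h].
  apply: inj_row_free => v; rewrite mulmx_sum_row => v0; apply/rowP => i.
  rewrite mxE; apply: (h (fun i => v 0 i)); rewrite -[RHS]v0.
  by apply: eq_bigr => j _; rewrite rowK.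
apply/(@freeP _ _ _ (in_tuple s)) => k k0 i.
have /eqP : (\row_i k i) *m (\matrix_(i < size s) s`_i) = 0.
  rewrite mulmx_sum_row -[RHS]k0; apply: eq_bigr => j _.
  by rewrite rowK mxE.
by rewrite mulmx_free_eq0 // => /eqP/rowP/(_ i); rewrite !mxE.
Qed.

End Homogenization.

Section Hull.
Local Open Scope classical_set_scope.
Context (R : realType) (N m : nat) (w : 'I_m.+1 -> 'rV[R]_N).
Local Notation I := 'I_m.+1.
Implicit Types (A B S : {set 'I_m.+1}) (x : 'rV[R]_N).
Local Notation u := (fun i => homog (w i)).

(** The convex hull of the points [w i] with [i] in [A], as a section of the
cone over their homogenizations; see [conv_hullE]. *)
Definition hull A : set 'rV[R]_N := [set x | in_cone u A (homog x)].

Let ue i : dot (u i) (height R N) = 1.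
Proof. exact: dot_height. Qed.

Lemma hull_sub A B : A \subset B -> hull A `<=` hull B.
Proof. by move=> AB x [l [l0 lA ex]]; exists l; split=> //; exact: fintype.subset_trans AB. Qed.

Lemma hull_vertex A i : i \in A -> hull A (w i).
Proof.
move=> iA; exists (fun j => (j == i)%:R); rewrite comb_delta; split => //.
by apply: supp_sub => j jA; case: eqP jA => // ->; rewrite iA.
Qed.

Lemma hull0 : hull finset.set0 = set0.
Proof.
apply/seteqP; split => // x [l [_ l0 ex]].
have := dot_height x; rewrite ex dot_comb big1 => [/esym/eqP|i _].
  by rewrite oner_eq0.
by rewrite (notin_supp l0) ?mul0r // inE.
Qed.

Lemma hull_neq0 A : (hull A !=set0) <-> A != finset.set0.
Proof.
split=> [[x hx]|/set0Pn[i iA]]; last by exists (w i); exact: hull_vertex.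
by apply: contraPneq hx => ->; rewrite hull0.
Qed.

Lemma hull_cone_face A B i : cone_face u A B -> i \in A -> hull B (w i) -> i \in B.
Proof.
move=> [c hc ->] iA [l [l0 lB ex]]; rewrite inE iA /=.
apply/eqP; rewrite ex; apply: comb_supp0 => j /(fintype.subsetP lB).
by rewrite inE => /andP[_ /eqP].
Qed.

Lemma hull_faces B i : B \in faces u -> hull B (w i) -> i \in B.
Proof. by move=> /facesP BL; apply: (hull_cone_face BL); rewrite inE. Qed.

Lemma hull_faces_sub A B : B \in faces u -> hull A `<=` hull B -> A \subset B.
Proof.
move=> BL AB; apply/fintype.subsetP => i iA; apply: hull_faces => //.
exact/AB/hull_vertex.
Qed.

Lemma hull_faces_inj A B : A \in faces u -> B \in faces u -> hull A = hull B -> A = B.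
Proof.
move=> AL BL AB; apply/eqP; rewrite finset.eqEsubset.
by rewrite !hull_faces_sub // AB.
Qed.

Lemma cone_face_hull A B (c : 'rV[R]_(1 + N)) :
  {in A, forall i, dot (u i) c <= 0} -> B = [set i in A | dot (u i) c == 0]%SET ->
  hull B = [set x | hull A x /\ dot (homog x) c = 0].
Proof.
move=> hc eB; have BA : B \subset A.
  by apply/fintype.subsetP => i; rewrite eB inE => /andP[].
apply/seteqP; split=> x /=.
  move=> [l [l0 lB ex]]; split.
    by exists l; split => //; exact: fintype.subset_trans BA.
  rewrite ex; apply: comb_supp0 => i /(fintype.subsetP lB).
  by rewrite eB inE => /andP[_ /eqP].
move=> [[l [l0 lA ex]] xc]; exists l; split => //.
apply/fintype.subsetP => i il; rewrite eB inE (fintype.subsetP lA) //=.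
rewrite ex in xc; rewrite (comb_face l0 _ xc) // => j jl.
by apply: hc; exact: (fintype.subsetP lA).
Qed.

(** The exposed faces of a hull correspond to the faces of its cone. *)
Lemma faceP A (F : set 'rV[R]_N) :
  face (hull A) F <-> exists2 B, cone_face u A B & F = hull B.
Proof.
split=> [[c [b [hc ->]]]|[B [c hc eB] ->]].
  pose c' : 'rV[R]_(1 + N) := row_mx (const_mx (- b)) c.
  have cE x : dot (homog x) c' = dot x c - b by rewrite dot_row_mx mul1r addrC.
  have hc' : {in A, forall i, dot (u i) c' <= 0}.
    by move=> i iA; rewrite cE subr_le0; apply/hc/hull_vertex.
  exists [set i in A | dot (u i) c' == 0]%SET; first by exists c'.
  rewrite (cone_face_hull hc' erefl); apply/seteqP; split=> x /= [xA].
    by move=> xb; split => //; rewrite cE /dot xb subrr.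
  by rewrite cE => /eqP; rewrite subr_eq0 => /eqP.
exists (rsubmx c), (- c 0 (lshift N 0)); split => [x xA|].
  have := dot_in_cone xA hc; rewrite dot_homog /dot; lra.
rewrite (cone_face_hull hc eB); apply/seteqP; split=> x /= [xA].
  by rewrite dot_homog /dot => h; split => //; lra.
by move=> h; split => //; rewrite dot_homog /dot h; lra.
Qed.

Lemma face_facesP A F : A \in faces u ->
  face (hull A) F <-> exists B, [/\ B \in faces u, B \subset A & F = hull B].
Proof.
move=> AL; rewrite faceP; split=> [[B hB ->]|[B [BL BA ->]]].
  by exists B; split=> //; [exact: cone_face_trans hB | exact: cone_face_sub hB].
by exists B => //; exact: faces_cone_face.
Qed.

Lemma nonempty_face_facesP A F : A \in faces u ->
  nonempty_face (hull A) F <->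
  exists B, [/\ B \in faces u, B != finset.set0, B \subset A & F = hull B].
Proof.
move=> AL; rewrite /nonempty_face face_facesP //.
split=> [[[B [BL BA ->]] /hull_neq0 B0]|[B [BL B0 BA ->]]]; first by exists B.
by split; [exists B | apply/hull_neq0].
Qed.

Lemma hull_convex A : @convex_set R 'rV[R]_N (hull A).
Proof.
move=> x y t; rewrite !inE => -[l [l0 lA ex]] [k [k0 kA ey]].
exists (fun i => t%:num * l i + (1 - t%:num) * k i); split.
- have t1 : t%:num <= 1 by exact: le1.
  by move=> i; rewrite addr_ge0 // mulr_ge0 // subr_ge0.
- apply: supp_sub => i iA; rewrite (notin_supp lA iA) (notin_supp kA iA).
  by rewrite !mulr0 addr0.
- by rewrite comb_lin -ex -ey; apply: homog_conv; rewrite addrC subrK.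
Qed.

Lemma conv_hullE A : conv_hull (w @` [set i | i \in A]) = hull A.
Proof.
apply/seteqP; split.
  apply: smallest_sub; first exact: hull_convex.
  by move=> _ [i iA <-]; exact: hull_vertex.
move=> x [l [l0 lA ex]] C [/= cC wC].
have [n] := ubnP #|supp l|; elim: n => // n IH in x l l0 lA ex *.
rewrite ltnS => ltn.
have suml y k : homog y = comb u k -> \sum_i k i = 1.
  move=> ey; rewrite -(dot_height y) ey dot_comb; apply: eq_bigr => i _.
  by rewrite dot_height mulr1.
have [l00|/set0Pn[i il]] := eqVneq (supp l) finset.set0.
  have := suml _ _ ex; rewrite big1 => [/esym/eqP|i _]; first by rewrite oner_eq0.
  by rewrite (@notin_supp _ _ l finset.set0) ?l00 ?inE.
have iA : i \in A by exact: (fintype.subsetP lA).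
have Ci : C (w i) by apply: wC; exists i.
have := suml _ _ ex; rewrite (bigD1 i) //= => sl.
have rest0 : 0 <= \sum_(j | j != i) l j by apply: sumr_ge0.
have [r0|rn0] := eqVneq (\sum_(j | j != i) l j) 0.
  have -> : x = w i => //; apply: homog_inj; rewrite ex /comb (bigD1 i) //=.
  have li : l i = 1 by move: sl; rewrite r0 addr0.
  rewrite li scale1r big1 ?addr0 // => j ji; move/eqP: r0.
  rewrite psumr_eq0 // => /allP/(_ j (mem_index_enum _)).
  by rewrite ji => /eqP ->; rewrite scale0r.
set r := \sum_(j | j != i) l j in sl rest0 rn0.
have rp : 0 < r by rewrite lt_def rn0.
have li0 := l0 i; have li1 : l i <= 1 by lra.
pose k j := if j == i then 0 else r^-1 * l j.
pose y := \sum_(j | j != i) (r^-1 * l j) *: w j.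
have xE : x = l i *: w i + r *: y.
  apply: homog_inj; rewrite homog_conv // ex /comb (bigD1 i) //=; congr (_ + _).
  rewrite /y /homog scale_row_mx.
  have -> : \sum_(j | j != i) l j *: row_mx (const_mx 1 : 'M_1) (w j) =
     row_mx (const_mx (\sum_(j | j != i) l j)) (\sum_(j | j != i) l j *: w j).
    elim/big_rec3: _ => [|j a b c _ ->]; first by rewrite row_mx0.
    rewrite scale_row_mx add_row_mx; congr row_mx.
    by apply/matrixP => i' j'; rewrite !mxE mulr1.
  congr row_mx; first by apply/matrixP => i' j'; rewrite !mxE mulr1.
  by rewrite scaler_sumr; apply: eq_bigr => j _; rewrite scalerA mulVKf.
have ek : homog y = comb u k.
  rewrite /comb (bigD1 i) //= {1}/k eqxx scale0r add0r.
  apply: (scalerI rn0); rewrite scaler_sumr.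
  have -> : \sum_(j | j != i) r *: (k j *: homog (w j)) = homog x - l i *: homog (w i).
    rewrite ex /comb [in RHS](bigD1 i) //= addrAC subrr add0r; apply: eq_bigr => j ji.
    by rewrite /k (negbTE ji) !scalerA mulVKf.
  by rewrite {1}xE homog_conv // addrAC subrr add0r.
have Cy : C y.
  apply: (IH y k) => //.
  - by move=> j; rewrite /k; case: eqP => // _; rewrite mulr_ge0 // invr_ge0.
  - apply: supp_sub => j jA; rewrite /k (notin_supp lA jA) mulr0.
    by case: ifP.
  - apply: leq_trans ltn; rewrite (cardsD1 i (supp l)) il add1n ltnS.
    apply/subset_leq_card/supp_sub => j; rewrite /k in_setD1 negb_and negbK.
    case: eqP => //= _; rewrite inE negbK => /eqP ->; by rewrite mulr0.
have := cC (w i) y (Itv01 li0 li1); rewrite !inE => /(_ Ci Cy).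
suff -> : x = l i *: w i + (1 - l i) *: y by [].
by rewrite {1}xE; congr (_ + _ *: _); lra.
Qed.

Lemma affdim_hull A : affdim (hull A) = (rk u A)%:Z - 1.
Proof.
rewrite /affdim; congr (Posz _ - 1); apply/eqP; rewrite eqn_leq; apply/andP; split.
  apply/bigmax_leqP => k /asboolP[s [<- si sA]].
  move: si; rewrite aff_indepE free_mx; set M := \matrix_(i < _) _.
  rewrite /row_free => /eqP rM; rewrite -(size_map (@homog R N) s) -rM.
  apply/mxrankS/row_subP => i; rewrite rowK.
  have [l [l0 lA]] : hull A s`_i by apply: sA; apply: mem_nth; rewrite -(size_map (@homog R N)).
  rewrite (nth_map 0) => [->|]; last by rewrite -(size_map (@homog R N)).
  exact: comb_sub.
have rN : (rk u A < N.+2)%N by rewrite ltnS /rk (leq_trans (rank_leq_col _)).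
apply: (@leq_bigmax_cond _ _ _ (Ordinal rN)); apply/asboolP => /=.
pose f := maxrankfun (masked u A).
have fA j : f j \in A.
  apply: contraT => jA; have := maxrowsub_free (masked u A).
  move/mulmx_free_eq0 => /(_ _ (delta_mx 0 j : 'rV__)).
  rewrite -rowE row_rowsub row_masked (negbTE jA) eqxx => /esym/eqP/rowP/(_ j).
  by rewrite !mxE !eqxx => /eqP; rewrite oner_eq0.
exists [seq w (f j) | j <- enum 'I_(rk u A)]; split.
- by rewrite size_map size_enum_ord.
- rewrite aff_indepE free_mx -map_comp.
  have := maxrowsub_free (masked u A); rewrite /row_free.
  set M := rowsub _ _; set M' := \matrix_(i < _) _ => /eqP rM.
  have sM' : size [seq (@homog R N \o (fun j => w (f j))) i | i <- enum 'I_(rk u A)] = rk u A.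
    by rewrite size_map size_enum_ord.
  rewrite eqn_leq rank_leq_row; apply: (@leq_trans (\rank M)).
    by rewrite rM sM'.
  apply/mxrankS/row_subP => j; rewrite /M row_rowsub row_masked fA.
  have jM : (j < size [seq (@homog R N \o (fun j => w (f j))) i | i <- enum 'I_(rk u A)])%N.
    by rewrite sM'.
  have -> : homog (w (f j)) = row (Ordinal jM) M'.
    rewrite rowK /= (nth_map j) ?size_enum_ord //=.
    by rewrite nth_ord_enum.
  exact: row_sub.
- by move=> _ /mapP[j _ ->]; exact: hull_vertex.
Qed.

Lemma hull_simplex A : free_on u A -> simplex (hull A).
Proof.
move=> fA; exists [seq w i | i <- enum A]; last first.
  rewrite -conv_hullE; congr conv_hull; apply/seteqP; split => x /=.
    by move=> [i iA <-]; apply/mapP; exists i => //; rewrite mem_enum.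
  by move=> /mapP[i]; rewrite mem_enum => iA ->; exists i.
rewrite aff_indepE -map_comp; apply/free_coefP => k.
set s := map _ _ => k0 j js.
have sE : size s = size (enum A) by rewrite size_map.
pose l i := if i \in A then k (index i (enum A)) else 0.
rewrite sE in js k0; have i0 : I by exact: ord0.
have sj i : (i < size (enum A))%N -> s`_i = homog (w (nth i0 (enum A) i)).
  by move=> h; rewrite (nth_map i0).
have := fA l; rewrite /l => /(_ _ _ (nth i0 (enum A) j)).
rewrite -(mem_enum A) mem_nth // index_uniq ?enum_uniq //; apply.
  by apply: supp_sub => i /negbTE ->.
rewrite -[RHS]k0 /comb (bigID (mem A)) /= [X in _ + X]big1 ?addr0; last first.
  by move=> i /negbTE ->; rewrite scale0r.
rewrite -big_enum (big_nth i0) big_mkord; apply: eq_bigr => i _.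
by rewrite -(mem_enum A) mem_nth // index_uniq ?enum_uniq // sj.
Qed.

End Hull.

(** * The pulling triangulation of a polytope *)

Local Open Scope classical_set_scope.
Local Open Scope ring_scope.

Lemma conv_hull_set0 (R : realType) N : conv_hull (set0 : set 'rV[R]_N) = set0.
Proof.
by apply/seteqP; split => //; apply: smallest_sub => // x y t; rewrite !inE.
Qed.

(** A nonempty polytope is the hull of a family of points each of which is an
exposed vertex: take a generating family of least size, and separate each
member from the cone over the others. *)
Lemma polytope_vertices (R : realType) N (P : set 'rV[R]_N) :
  polytope P -> P !=set0 -> exists m (w : 'I_m.+1 -> 'rV[R]_N),
    P = hull w finset.setT /\ forall i, finset.set1 i \in faces (fun i => homog (w i)).
Proof.
move=> [X /finite_seqP[s0 ->] Ps0] P0.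
pose Q n := `[< exists2 s : seq 'rV[R]_N, size s = n & P = conv_hull [set` s] >].
have exQ : exists n, Q n by exists (size s0); apply/asboolP; exists s0.
case: (ex_minnP exQ) => n /asboolP[s sn Ps] nmin.
have [m nm] : exists m, n = m.+1.
  case: n => [|m] in sn nmin *; last by exists m.
  move: P0; rewrite Ps; have -> : s = [::] by apply/nilP; rewrite /nilp sn.
  rewrite (_ : [set` [::]] = set0); last by apply/seteqP; split.
  by rewrite conv_hull_set0 => -[].
exists m, (fun i => s`_i); set w := fun i : 'I_m.+1 => s`_i.
have Pw : P = hull w finset.setT.
  rewrite Ps -conv_hullE; congr conv_hull; apply/seteqP; split => x /=.
    move=> /(nthP 0)[i]; rewrite sn nm => im <-.
    by exists (Ordinal im) => //; rewrite inE.
  by move=> [i _ <-]; apply: mem_nth; rewrite sn nm.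
split => // i; set u := fun i => homog (w i).
have [c hc ci] : exists2 c, {in finset.setD finset.setT (finset.set1 i),
    forall j, dot (u j) c <= 0} & 0 < dot (u i) c.
  apply: contrapT => nex.
  have ui : in_cone u (finset.setD finset.setT (finset.set1 i)) (u i).
    apply: in_cone_farkas => c hc; rewrite leNgt; apply/negP => ci.
    by apply: nex; exists c.
  have : Q m; last by move/nmin; rewrite nm ltnn.
  apply/asboolP.
  exists [seq w j | j <- enum (finset.setD finset.setT (finset.set1 i))].
    rewrite size_map -cardE cardsDS ?finset.subsetT //.
    by rewrite cards1 cardsT card_ord subn1.
  rewrite (_ : [set` _] = w @` [set j | j \in finset.setD finset.setT (finset.set1 i)]).
    rewrite conv_hullE Pw; apply/seteqP; split; last exact/hull_sub/finset.subsetT.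
    move=> x hx; apply: in_cone_farkas => c hc; apply: (dot_in_cone hx) => j _.
    have [->|ji] := eqVneq j i; first exact: dot_in_cone ui hc.
    by apply: hc; rewrite !inE ji.
  apply/seteqP; split => x /=.
    by move=> /mapP[j]; rewrite mem_enum => hj ->; exists j.
  by move=> [j hj <-]; apply/mapP; exists j => //; rewrite mem_enum.
apply/facesP; exists (c - dot (u i) c *: height R N).
  move=> j _; rewrite dotDr dotNr dotZr dot_height mulr1.
  have [->|ji] := eqVneq j i; first by rewrite subrr.
  have := hc j; rewrite !inE ji => /(_ isT); lra.
apply/setP => j; rewrite !inE dotDr dotNr dotZr dot_height mulr1.
have [->|ji] := eqVneq j i; first by rewrite subrr eqxx.
apply/esym/negbTE; have := hc j; rewrite !inE ji => /(_ isT) h.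
by rewrite lt_eqF //; lra.
Qed.

Section Assembly.
Context (R : realType) (N m : nat) (w : 'I_m.+1 -> 'rV[R]_N).
Local Notation I := 'I_m.+1.
Local Notation u := (fun i => homog (w i)).
Hypothesis vertices : forall i, finset.set1 i \in faces u.
Local Notation L := (faces u).
Local Notation K := (pulling_complex L).
Local Notation cl := (closure_of L).
Local Notation hull := (hull w).
Local Notation P := (hull finset.setT).
Implicit Types (A B S T : {set 'I_m.+1}).

Let ue i : dot (u i) (height R N) = 1.
Proof. exact: dot_height. Qed.
Let LT := faces_setT u.
Let L0 := faces_set0 ue.
Let LI := @faces_setI _ _ _ u.

(** The pulling triangulation. *)
Definition simplices : set (set 'rV[R]_N) := hull @` [set` K].

(** The indices of the vertices lying in [F]. *)
Definition vertex_set (F : set 'rV[R]_N) : {set I} := finset (fun i => `[< F (w i) >]).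

(** The apex of a face: its vertex of least index. *)
Definition apex_of F := w (apex (vertex_set F)).

Lemma vertex_set_hull A : A \in L -> vertex_set (hull A) = A.
Proof.
move=> AL; apply/setP => i; rewrite inE; apply/asboolP/idP.
  exact: hull_faces.
exact: hull_vertex.
Qed.

Lemma hull1 i : hull (finset.set1 i) = [set w i].
Proof.
apply/seteqP; split => x /= => [[l [l0 li ex]]|->]; last by apply: hull_vertex; rewrite set11.
have e1 : comb u l = l i *: homog (w i).
  rewrite /comb (bigD1 i) //= big1 ?addr0 // => j ji.
  by rewrite (notin_supp li) ?scale0r // inE.
have li1 : l i = 1.
  by have := dot_height x; rewrite ex e1 dotZl dot_height mulr1.
by apply: homog_inj; rewrite ex e1 li1 scale1r.
Qed.

(** A simplex of the triangulation contains no other vertex than its own. *)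
Lemma hull_pulling T i : T \in K -> hull T (w i) -> i \in T.
Proof.
move=> TK [l [l0 lT ex]].
have di : supp (fun j => (j == i)%:R : R) = finset.set1 i.
  by apply/setP => j; rewrite !inE pnatr_eq0 eqb0 negbK.
have E : l =1 (fun j => (j == i)%:R).
  apply: (pulling_unique ue) => //.
  - exact: pulling_sub TK lT.
  - by rewrite di; apply: pulling1.
  - by rewrite comb_delta -ex.
by apply: (fintype.subsetP lT); rewrite inE E eqxx oner_eq0.
Qed.

Lemma hull_pulling_inj S T : S \in K -> T \in K -> hull S = hull T -> S = T.
Proof.
move=> SK TK ST; apply/eqP; rewrite finset.eqEsubset.
apply/andP; split; apply/fintype.subsetP => i iS; apply: hull_pulling => //.
  by rewrite -ST; exact: hull_vertex.
by rewrite ST; exact: hull_vertex.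
Qed.

Lemma hull_pulling_setI S T : S \in K -> T \in K ->
  hull S `&` hull T = hull (S :&: T).
Proof.
move=> SK TK; apply/seteqP; split => x; last first.
  by move=> h; split; apply: hull_sub h; [exact: finset.subsetIl | exact: finset.subsetIr].
move=> [[l [l0 lS ex]] [k [k0 kT ey]]].
have E : l =1 k.
  by apply: (pulling_unique ue) => //;
    [exact: pulling_sub lS | exact: pulling_sub kT | rewrite -ex].
by exists l; split => //; rewrite finset.subsetI lS (eq_supp E).
Qed.

Lemma rk_pulling S : S \in K -> rk u S = #|S|.
Proof. by move=> SK; apply/rk_free/(pulling_free ue). Qed.

Lemma affdim_pulling S : S \in K -> affdim (hull S) = #|S|%:Z - 1.
Proof. by move=> SK; rewrite affdim_hull rk_pulling. Qed.

Lemma simplices_triangulation : triangulation P simplices.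
Proof.
split.
- split; first exact/finite_image/finite_finset.
  by exists finset.set0; [exact: pulling0 | exact: hull0].
- by move=> _ [S SK <-]; apply/hull_simplex/(pulling_free ue).
- move=> _ tau [S SK <-] /faceP[B /cone_face_sub BS ->].
  by exists B => //; exact: pulling_sub BS.
- move=> _ _ [S SK <-] [T TK <-]; rewrite hull_pulling_setI //; split; apply/faceP;
    exists (S :&: T) => //; apply: (pulling_cone_face ue) => //.
    exact: finset.subsetIl.
  exact: finset.subsetIr.
- apply/seteqP; split => [x [_ [S SK <-]]|x [l [l0 _ ex]]].
    exact/hull_sub/finset.subsetT.
  have [k [k0 kK _ ek]] := pulling_cover ue LT l0 (finset.subsetT _).
  exists (hull (supp k)); first by exists (supp k).
  by exists k; split => //; rewrite ek.
Qed.

Lemma Vert_hull A x : A \in L -> Vert (hull A) x <-> exists2 i, i \in A & x = w i.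
Proof.
move=> AL; rewrite /Vert /= face_facesP //; split => [[B [BL BA eB]]|[i iA ->]].
  have /set0Pn[i iB] : B != finset.set0 by apply/(hull_neq0 w); rewrite -eB; exists x.
  exists i; first exact: (fintype.subsetP BA).
  by have := hull_vertex w iB; rewrite -eB.
by exists (finset.set1 i); rewrite finset.sub1set hull1.
Qed.

Lemma pulling_edge A i : A \in L -> i \in A ->
  (apex A |: finset.set1 i)%SET \in K.
Proof.
move=> AL iA; apply: pulling_cone => //; last by rewrite finset.sub1set.
  by apply/set0Pn; exists i.
exact: pulling1.
Qed.

Lemma simplices_pointed : pointed_triangulation P simplices apex_of.
Proof.
split; first exact: simplices_triangulation.
- move=> F /(nonempty_face_facesP _ LT)[A [AL A0 _ ->]].
  apply/Vert_hull => //; exists (apex A); first exact: apex_in.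
  by rewrite /apex_of vertex_set_hull.
- move=> k F sigma /(nonempty_face_facesP _ LT)[A [AL A0 _ ->]] dA [[S SK <-]].
  move=> /(hull_faces_sub AL) SA dS; rewrite /apex_of vertex_set_hull //.
  apply: hull_vertex; apply: contraT => aS.
  have aSA : (apex A |: S)%SET \subset A by rewrite finset.subUset finset.sub1set apex_in.
  have := rk_mono u aSA; rewrite rk_pulling; last exact: pulling_cone.
  rewrite cardsU1 aS; move: dA dS; rewrite affdim_hull affdim_pulling //; lia.
- move=> F1 F2 /(nonempty_face_facesP _ LT)[A [AL A0 _ ->]].
  move=> /(nonempty_face_facesP _ LT)[B [BL B0 _ ->]].
  rewrite /apex_of !vertex_set_hull // => h.
  have [_ /(hull_faces BL) aB] := h (w (apex A)) (or_introl erefl).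
  have [/(hull_faces AL) bA _] := h (w (apex B)) (or_intror erefl).
  by congr w; apply/val_inj/eqP; rewrite eqn_leq !apex_le.
- move=> F x /(nonempty_face_facesP _ LT)[A [AL A0 _ ->]] [/(Vert_hull _ AL)[i iA ->] _].
  have -> : conv_hull [set apex_of (hull A); w i] = hull (apex A |: finset.set1 i)%SET.
    rewrite /apex_of vertex_set_hull // -conv_hullE; congr conv_hull.
    apply/seteqP; split => y /=.
      by move=> [->|->]; [exists (apex A) | exists i] => //; rewrite !inE eqxx ?orbT.
    by move=> [j]; rewrite !inE => /orP[/eqP ->|/eqP ->] <-; [left | right].
  split; first by exists (apex A |: finset.set1 i)%SET => //; exact: pulling_edge.
  by apply: hull_sub; rewrite finset.subUset !finset.sub1set apex_in.
Qed.

(** The polytope numbers of a face, in closed form. *)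
Definition num (F : set 'rV[R]_N) (n : nat) : int :=
  match n with
  | 0 => 0
  | 1 => 1
  | k.+2 => (simplex_count L (vertex_set F) k)%:Z
  end.

(** The interior polytope numbers of a face, in closed form; at index 1 only
vertices have a nonzero value. *)
Definition inum (F : set 'rV[R]_N) (n : nat) : int :=
  match n with
  | 0 => 0
  | 1 => (#|vertex_set F| == 1%N)%:Z
  | k.+2 => (interior_count L (vertex_set F) k)%:Z
  end.

(** Sums over nonempty faces of a face are sums over members of [faces]. *)
Lemma fsum_faces A (q : pred {set I}) (Q : set 'rV[R]_N -> Prop) (f : set 'rV[R]_N -> int) :
  A \in L -> (forall B, B \in L -> Q (hull B) <-> q B) ->
  \sum_(G \in [set G | nonempty_face (hull A) G /\ Q G]) f G =
  \sum_(B in L | [&& B != finset.set0, B \subset A & q B]) f (hull B).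
Proof.
move=> AL qQ.
pose D := finset (fun B => (B \in L) && [&& B != finset.set0, B \subset A & q B]).
have -> : [set G | nonempty_face (hull A) G /\ Q G] = hull @` [set` enum D].
  apply/seteqP; split => G /=.
    move=> [/(nonempty_face_facesP _ AL)[B [BL B0 BA ->]] /(qQ B BL) qB].
    by exists B => //; rewrite /= mem_enum inE BL B0 BA.
  move=> [B]; rewrite /= mem_enum inE => /and4P[BL B0 BA /(qQ B BL) qB] <-; split => //.
  by apply/nonempty_face_facesP => //; exists B.
rewrite fsbig_image; last first.
  move=> B B'; rewrite !inE /= !mem_enum !inE => /andP[BL _] /andP[BL' _].
  by move=> h; apply: hull_faces_inj h; rewrite inE.
rewrite -(@fsbig_seq _ _ _ _ (enum D) (fun B => f (hull B))) ?enum_uniq // big_enum /=.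
by apply: eq_bigl => B; rewrite inE.
Qed.

Lemma affdim_eq0 A : A \in L -> A != finset.set0 ->
  (affdim (hull A) == 0) = (#|A| == 1%N).
Proof.
move=> AL A0; rewrite affdim_hull; apply/eqP/cards1P => [h|[a ->]]; last first.
  by rewrite rk_pulling ?cards1 ?subrr //; exact: pulling1.
exists (apex A); apply/setP => i; rewrite inE; apply/idP/eqP => [iA|->]; last exact: apex_in.
apply/eqP; apply: contraT => ia.
have eA : (apex A |: finset.set1 i)%SET \subset A by rewrite finset.subUset !finset.sub1set apex_in.
have := rk_mono u eA; rewrite rk_pulling; last exact: pulling_edge.
by rewrite cardsU1 cards1 inE eq_sym ia; lia.
Qed.

Lemma simplex_count1 a k : simplex_count L (finset.set1 a) k = 1%N.
Proof.
rewrite /simplex_count (big_pred1 (finset.set1 a)) => [|S]; first by rewrite cards1 bin0.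
rewrite /= finset.subset1; apply/andP/eqP => [[SK /andP[S0 /orP[/eqP //|S0']]]|->].
  by rewrite S0' in S0.
rewrite pulling1 // eqxx /=; split => //; rewrite andbT.
by apply/set0Pn; exists a; rewrite set11.
Qed.

Lemma interior_count1 a k : interior_count L (finset.set1 a) k = 1%N.
Proof.
rewrite /interior_count (big_pred1 (finset.set1 a)) => [|S]; first by rewrite cards1 bin0.
apply/andP/eqP => [[SK /andP[S0 /eqP clS]]|->].
  have := sub_closure L S; rewrite clS finset.subset1 => /orP[/eqP //|S0'].
  by rewrite S0' in S0.
rewrite pulling1 // closure_id // eqxx; split => //; rewrite andbT.
by apply/set0Pn; exists a; rewrite set11.
Qed.

Lemma num_polytope_numbers : polytope_numbers P apex_of num inum.
Proof.
move=> F /(nonempty_face_facesP _ LT)[A [AL A0 _ ->]]; split => //.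
- move=> /eqP; rewrite affdim_eq0 // => /cards1P[a eA] [|[|k]] // _.
    by rewrite /inum vertex_set_hull // eA cards1.
  by rewrite /num /inum vertex_set_hull // eA simplex_count1 interior_count1.
- move=> dA; have A1 : (#|A| == 1%N) = false.
    by rewrite -affdim_eq0 // gt_eqF.
  split=> //; first by rewrite /inum vertex_set_hull // A1.
  move=> [|[|k]] // _; split.
    rewrite (@fsum_faces A (fun B => apex A \notin B)) //; last first.
      move=> B BL; rewrite /apex_of vertex_set_hull //; split => [h|/negP h].
        by apply/negP => aB; apply: h; exact: hull_vertex.
      by move=> /(hull_faces BL).
    rewrite (eq_bigr (fun B => (interior_count L B k)%:Z)); last first.
      by move=> B /andP[BL _]; rewrite /inum vertex_set_hull.
    rewrite -(big_morph Posz PoszD (erefl _)) /num vertex_set_hull //=.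
    case: k => [|k]; first by rewrite simplex_count0.
    by rewrite simplex_countS.
  rewrite (@fsum_faces A (fun B => B != A)) //; last first.
    move=> B BL; split=> [h|/eqP h /(hull_faces_inj BL AL) //].
    by apply/eqP => BA; rewrite BA in h.
  rewrite (eq_bigr (fun B => (interior_count L B k)%:Z)); last first.
    by move=> B /andP[BL _]; rewrite /inum vertex_set_hull.
  rewrite -(big_morph Posz PoszD (erefl _)) /num /inum vertex_set_hull //.
  rewrite simplex_count_faces // (bigD1 A) /=; last by rewrite AL A0 subxx.
  rewrite PoszD (eq_bigl (fun B => (B \in L) &&
    [&& B != finset.set0, B \subset A & B != A])) ?addrK // => B.
  by rewrite -!andbA.
Qed.

Lemma fvec_face_number i : fvec simplices (i%:Z - 1) = face_number K i.
Proof.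
rewrite /fvec /face_number.
pose D := finset (fun S => (S \in K) && (#|S| == i)).
have -> : [set sigma | simplices sigma /\ affdim sigma = i%:Z - 1] =
    [set` [fset hull S | S in D]%fset].
  apply/seteqP; split => s /=.
    move=> [[S SK <-]]; rewrite affdim_pulling // => /addIr[Si].
    by apply/imfsetP; exists S => //=; rewrite inE SK Si eqxx.
  move=> /imfsetP[S]; rewrite /= inE => /andP[SK /eqP Si] ->.
  by split; [exists S | rewrite affdim_pulling // Si].
rewrite set_fsetK card_in_imfset /=; last first.
  move=> S T /= SD TD; apply: hull_pulling_inj.
    by move: SD; rewrite inE => /andP[].
  by move: TD; rewrite inE => /andP[].
by rewrite -cardE; apply: eq_card => S; rewrite !inE.
Qed.

Lemma hvec_h_number d k : hvec d simplices k = h_number K d k.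
Proof. by apply: eq_bigr => i _; rewrite fvec_face_number. Qed.

Lemma num_formula d n : affdim P = d%:Z -> (1 <= d)%N -> (1 <= n)%N ->
  num P n = \sum_(0 <= j < d) hvec d simplices j * alpha d (n%:Z - j%:Z).
Proof.
rewrite affdim_hull => hdim d0; have rkT : rk u finset.setT = d.+1 by lia.
under eq_bigr => j _ do rewrite hvec_h_number.
case: n => [|[|k]] // _.
  rewrite big_ltn // big_nat big1 ?addr0 => [|j /andP[j0 jd]]; last first.
    rewrite /alpha ifF ?mulr0 //; lia.
  rewrite /h_number big_nat1 /face_number.
  have -> : #|finset (fun S => (S \in K) && (#|S| == 0%N))| = 1%N.
    apply/eqP/cards1P; exists finset.set0; apply/setP => S; rewrite !inE cards_eq0.
    apply: andb_idl => /eqP ->; have := pulling0 L; by rewrite inE.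
  by rewrite /alpha /= add1n subn1 !subn0 !binn.
have [N' [cex cuniq Nsub Nsmall]] := half_open_cells ue vertices rkT d0.
have Ksub S M : M \in K -> S \subset M -> S \in K by exact: pulling_sub.
rewrite [RHS](h_number_formula Ksub cex cuniq Nsub Nsmall k) /num vertex_set_hull //.
by congr Posz; apply: eq_bigl => S; rewrite finset.subsetT andbT.
Qed.

End Assembly.

Theorem theorem1 (R : realType) (N d : nat) (P : set 'rV[R]_N)
    (hP : polytope P) (hdim : affdim P = d%:Z) (hd : (1 <= d)%N) :
  exists (C : set (set 'rV[R]_N)) (v : set 'rV[R]_N -> 'rV[R]_N),
    pointed_triangulation P C v /\
    exists num inum : set 'rV[R]_N -> nat -> int,
      polytope_numbers P v num inum /\
      forall n : nat, (1 <= n)%N ->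
        num P n = \sum_(0 <= j < d) hvec d C j * alpha d (n%:Z - j%:Z).
Proof.
have P0 : P !=set0.
  apply/set0P; apply: contraTneq hd => P0; rewrite -leqNgt.
  move: hdim; rewrite P0 /affdim big1 => [|k].
    by case: (d).
  move=> /asboolP[[|x s] [<- _ sub]] //.
  by case: (sub x); rewrite /= mem_head.
have [m [w [PE vert]]] := polytope_vertices hP P0; rewrite PE in hdim *.
exists (simplices w), (apex_of w); split; first exact: simplices_pointed.
exists (num w), (inum w); split; first exact: num_polytope_numbers.
by move=> n; exact: num_formula.
Qed.
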